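(* Let $p\in(0,\infty)$, $\alpha\in(0,1)$, and let $\{p,\kappa_d\}\in\mathbb{T}_\alpha$. Then: 1. If $p\in[2,\infty)$, then for every $\boldsymbol{\vartheta}=\{\boldsymbol{\theta}_d:d\in\mathbb{N}\}\in\boldsymbol{\Theta}$, $$\boldsymbol{\vartheta}\in\mathscr{C}(\{p,\kappa_d\})\quad\Longleftrightarrow\quad d^{-1/2}\max\left(\|\boldsymbol{\theta}_d\|_2^2,\ \|\boldsymbol{\theta}_d\|_p^p\right)\to\infty.$$ 2. If $p\in(0,2)$, then for every $\boldsymbol{\vartheta}=\{\boldsymbol{\theta}_d:d\in\mathbb{N}\}\in\boldsymbol{\Theta}$, $$\boldsymbol{\vartheta}\in\mathscr{C}(\{p,\kappa_d\})\quad\Longrightarrow\quad d^{-1/2}\min\left(\|\boldsymbol{\theta}_d\|_2^2,\ \|\boldsymbol{\theta}_d\|_p^p\right)\to\infty;$$ but the condition on the right does not imply the condition on the left, i.e., there exists $\boldsymbol{\vartheta}\in\boldsymbol{\Theta}$ satisfying the condition on the right with $\boldsymbol{\vartheta}\notin\mathscr{C}(\{p,\kappa_d\})$.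
   Context: Let $\varepsilon_1,\varepsilon_2,\dots$ be i.i.d. standard normal random variables and $\boldsymbol{\varepsilon}_d = (\varepsilon_1,\dots,\varepsilon_d)$. A (sequence of) test(s) is a sequence $\varphi_d$, $d\in\mathbb{N}$, of Borel measurable functions $\varphi_d:\mathbb{R}^d \to [0,1]$; it has asymptotic size $\alpha\in[0,1]$ if $\lim_{d\to\infty}\mathbb{E}(\varphi_d(\boldsymbol{\varepsilon}_d)) = \alpha$, and $\mathbb{T}_\alpha$ denotes the set of all sequences of tests with asymptotic size $\alpha$. Let $\boldsymbol{\Theta} := \prod_{d=1}^\infty \mathbb{R}^d$ be the set of all triangular arrays $\boldsymbol{\vartheta} = \{\boldsymbol{\theta}_d: d\in\mathbb{N}\}$, $\boldsymbol{\theta}_d\in\mathbb{R}^d$. The consistency set $\mathscr{C}(\varphi_d)\subseteq\boldsymbol{\Theta}$ of a sequence of tests $\varphi_d$ is the set of all $\boldsymbol{\vartheta}\in\boldsymbol{\Theta}$ with $\lim_{d\to\infty}\mathbb{E}(\varphi_d(\boldsymbol{\theta}_d+\boldsymbol{\varepsilon}_d)) = 1$. For $\boldsymbol{x}\in\mathbb{R}^d$ and $p\in(0,\infty)$, $\|\boldsymbol{x}\|_p := (\sum_{i=1}^d |x_i|^p)^{1/p}$ (also for $p<1$). For a sequence of real critical values $\kappa_d$, $\{p,\kappa_d\}$ denotes the sequence of tests $\mathbf{1}\{\|\cdot\|_p \ge \kappa_d\}$. *)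

(* Defs.v *)
From HB Require Import structures.
From mathcomp Require Import all_boot all_order all_algebra finmap.
From mathcomp Require Import all_classical all_reals all_analysis.

Set Implicit Arguments.
Unset Strict Implicit.
Unset Printing Implicit Defensive.

Import Order.TTheory GRing.Theory Num.Theory.
Import numFieldNormedType.Exports.

Local Open Scope classical_set_scope.
Local Open Scope ring_scope.

(* Sequences over d = 1, 2, ... are indexed by d : nat, the dimension. The
   term d = 0 lives on the one-point space R^0 and affects no limit. *)

Definition mutually_independent (R : realType) (disp : measure_display)
    (T : measurableType disp) (P : probability T R) (I : choiceType)
    (X : I -> {RV P >-> R}) : Prop :=
  forall (J : {fset I}) (A : I -> set R),
    (forall j, j \in J -> measurable (A j)) ->
    P (\bigcap_(j in [set` J]) (X j @^-1` A j)) =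
      (\prod_(j <- J) P (X j @^-1` A j))%E.

(* Laws are compared on Borel sets only: equality of the library's measures as
   functions on all sets would also constrain meaningless values. *)
Definition standard_normal (R : realType) (disp : measure_display)
    (T : measurableType disp) (P : probability T R)
    (X : {RV P >-> R}) : Prop :=
  forall A : set R, measurable A -> P (X @^-1` A) = normal_prob 0 1 A.

Definition iid_standard_normal (R : realType) (disp : measure_display)
    (T : measurableType disp) (P : probability T R)
    (eps : nat -> {RV P >-> R}) : Prop :=
  mutually_independent eps /\ forall i, standard_normal (eps i).

(* eps i stands for epsilon_(i+1). *)
Definition noise (R : realType) (disp : measure_display)
    (T : measurableType disp) (P : probability T R)
    (eps : nat -> {RV P >-> R}) (d : nat) (w : T) : 'rV[R]_d :=
  \row_(i < d) eps i w.

Definition borel_measurable (R : realType) (d : nat) (f : 'rV[R]_d -> R)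
    : Prop :=
  forall B : set R, measurable B ->
    <<s [set U : set 'rV[R]_d | open U] >> (f @^-1` B).

Definition is_test (R : realType) (phi : forall d : nat, 'rV[R]_d -> R)
    : Prop :=
  forall d, borel_measurable (phi d) /\ forall x, 0 <= phi d x <= 1.

Definition tests_of_size (R : realType) (disp : measure_display)
    (T : measurableType disp) (P : probability T R)
    (eps : nat -> {RV P >-> R}) (alpha : R)
    : set (forall d : nat, 'rV[R]_d -> R) :=
  [set phi | is_test phi /\
    ('E_P[fun w => phi d (noise eps d w)])%E @[d --> \oo] --> alpha%:E].

Definition triangular_array (R : realType) : Type :=
  forall d : nat, 'rV[R]_d.

Definition consistency_set (R : realType) (disp : measure_display)
    (T : measurableType disp) (P : probability T R)
    (eps : nat -> {RV P >-> R}) (phi : forall d : nat, 'rV[R]_d -> R)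
    : set (triangular_array R) :=
  [set theta |
    ('E_P[fun w => phi d (theta d + noise eps d w)%R])%E
      @[d --> \oo] --> (1 : R)%:E].

Definition pnorm (R : realType) (d : nat) (p : R) (x : 'rV[R]_d) : R :=
  (\sum_(i < d) `|x 0 i| `^ p) `^ p^-1.

Definition pnorm_test (R : realType) (p : R) (kappa : nat -> R)
    (d : nat) : 'rV[R]_d -> R :=
  \1_[set x | kappa d <= pnorm p x].

(* Main.v *)
(* The power of [{p, kappa_d}] against [theta] is the probability that
   [S = sum_i |theta_i + eps_i|^p] exceeds a threshold, which the size condition
   places within [O(sqrt d)] of the null mean [d * mu]. With [w(t) = t^2] for
   [|t| <= 1] and [w(t) = |t|^p] otherwise, [E|t + eps|^p <= mu + C w(t)], and for
   [p >= 2] symmetrisation and convexity give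
   [E|t + eps|^p >= mu + c max(t^2, |t|^p)]; Chebyshev's inequality then yields
   consistency for [p >= 2].
   For necessity no central limit theorem is needed. Reweighting every
   coordinate by a density [1 + (c / sqrt d) psi] with [E psi = 0] and
   [E psi |eps|^p < 0] lowers the mean of [S] by a large multiple of [sqrt d],
   so under the reweighted law [S] stays below the threshold with probability at
   least 1/2 whenever [sum_i w(theta_i) = O(sqrt d)]. The likelihood ratio has
   second moment at most [exp(c^2)], so the original probability of this event is
   bounded below too. The counterexample for [p < 2] has one coordinate
   [d^(1/(2p))] and all others [d^(-1/4)]. *)

Require Import Defs.
From HB Require Import structures.
From mathcomp Require Import all_boot all_order all_algebra finmap.
From mathcomp Require Import all_classical all_reals all_analysis.
From mathcomp Require Import measurable_realfun.
From mathcomp Require Import ring lra.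

Set Implicit Arguments.
Unset Strict Implicit.
Unset Printing Implicit Defensive.

Import Order.TTheory GRing.Theory Num.Theory.
Import numFieldNormedType.Exports.

Local Open Scope classical_set_scope.
Local Open Scope ring_scope.

(** * Change of variables for the image of a measure with a density *)

Section weighted_transfer.
Local Open Scope ereal_scope.
Context (d1 d2 : measure_display) (X : measurableType d1)
  (Y : measurableType d2) (R : realType).
Context (mu : {measure set X -> \bar R}) (nu : {measure set Y -> \bar R}).
Context (h : X -> R) (phi : X -> Y).
Hypotheses (mh : measurable_fun setT h) (h0 : forall x, (0 <= h x)%R).
Hypothesis mphi : measurable_fun setT phi.
Hypothesis indicE : forall A, measurable A ->
  \int[mu]_x (h x * \1_A (phi x))%:E = nu A.

Import HBNNSimple.

(** By [indicE], [nu] is the image under [phi] of the measure with density [h], a measure that is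
    never constructed. The identity passes from indicators to simple functions by additivity over
    level sets, and to [f] by monotone convergence. It serves both for Gaussian densities and for
    exchanging one factor of a product of independent variables. *)
Lemma weighted_transfer (f : Y -> \bar R) : measurable_fun setT f ->
  (forall y, 0 <= f y) -> \int[mu]_x ((h x)%:E * f (phi x)) = \int[nu]_y f y.
Proof.
move=> mf f0.
pose f_ := nnsfun_approx measurableT mf.
transitivity (limn (fun n => \int[nu]_y (f_ n y)%:E)); last first.
  rewrite -monotone_convergence//.
  - by apply: eq_integral => y _; apply/cvg_lim => //; apply: cvg_nnsfun_approx.
  - by move=> n; exact/measurable_EFinP/measurable_funP.
  - by move=> n y _; rewrite lee_fin.
  - by move=> y _ m n mn; rewrite lee_fin; exact/lefP/nd_nnsfun_approx.
have mfn n : measurable_fun setT (f_ n \o phi).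
  by apply: measurableT_comp => //; exact: measurable_funP.
transitivity (limn (fun n => \int[mu]_x ((h x)%:E * (f_ n (phi x))%:E))).
  rewrite -monotone_convergence//.
  - apply: eq_integral => x _; apply/esym/cvg_lim => //; apply: cvgeZl => //.
    by apply: cvg_nnsfun_approx.
  - by move=> n; apply/emeasurable_funM; apply/measurable_EFinP => //; exact: mfn.
  - by move=> n x _; rewrite -EFinM lee_fin mulr_ge0.
  - move=> x _ m n mn; rewrite -!EFinM lee_fin ler_wpM2l//.
    exact/lefP/nd_nnsfun_approx.
congr (limn _); apply/funext => n.
have mA r : measurable (f_ n @^-1` [set r]) by [].
(* A simple function is a finite combination of indicators of its level sets, to which [indicE]
   applies. *)
transitivity (\int[mu]_x (\sum_(r \in range (f_ n))
    (r%:E * (h x * \1_(f_ n @^-1` [set r]) (phi x))%:E))).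
  apply: eq_integral => x _; rewrite [f_ n (phi x)]fimfunE -fsumEFin// muleC.
  rewrite ge0_mule_fsuml => [|r]; last exact: nnfun_muleindic_ge0.
  by apply: eq_fsbigr => r _; rewrite -!EFinM -mulrA [X in (_ * X)%R]mulrC.
rewrite ge0_integral_fsum//; last 2 first.
- move=> r; apply/emeasurable_funM => //; apply/measurable_EFinP.
  by apply: measurable_funM => //; apply: measurableT_comp.
- move=> r x _; have [r0|r0] := leP 0%R r.
    by rewrite -EFinM lee_fin !mulr_ge0.
  by rewrite preimage_nnfun0// indic0 mulr0 mule0.
transitivity (\int[nu]_y (\sum_(r \in range (f_ n))
   (r * \1_(f_ n @^-1` [set r]) y)%:E)); last first.
  by apply: eq_integral => y _; rewrite fimfunE -fsumEFin.
rewrite ge0_integral_fsum//; last 2 first.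
- by move=> r; apply/measurable_EFinP/measurable_funM.
- by move=> r y _; exact: nnfun_muleindic_ge0.
apply: eq_fsbigr => r rf.
have r0 : (0 <= r)%R by move: rf; rewrite inE => -[y _ <-].
rewrite ge0_integralZl_EFin//.
- under [RHS]eq_integral do rewrite EFinM.
  rewrite ge0_integralZl_EFin//.
  + by rewrite indicE// integral_indic// setIT.
  + exact/measurable_EFinP.
- by move=> z _; rewrite lee_fin mulr_ge0.
- apply/measurable_EFinP; apply: measurable_funM => //.
  by apply: measurableT_comp.
Qed.

End weighted_transfer.

(** * Expectation of a product of functions of independent variables *)

Section independent_product.
Context (R : realType) (disp : measure_display) (T : measurableType disp)
  (P : probability T R) (X : nat -> {RV P >-> R})
  (nu : probability R R).
Hypothesis indepX : mutually_independent X.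
Hypothesis lawX : forall i A, measurable A -> P (X i @^-1` A) = nu A.

(** Induction on the number [k] of functions allowed to be arbitrary, the others being indicators.
    For [k = 0] this is independence of events. In the step, the [k]-th function is first an
    indicator, and [weighted_transfer] then frees it, with the product of the other factors as
    weight. *)
Let hybrid_product k n (f : nat -> R -> R) (m : nat -> R) :
  (forall i, measurable_fun setT (f i)) -> (forall i x, 0 <= f i x) ->
  (forall i, (\int[nu]_x (f i x)%:E = (m i)%:E)%E) ->
  (forall i, (k <= i)%N -> exists2 A, measurable A & f i = \1_A) ->
  (\int[P]_w (\prod_(i < n) f i (X i w))%:E = (\prod_(i < n) m i)%:E)%E.
Proof.
elim: k f m => [|k IHk] f m mf f0 fm fA.
  have {fA} /choice[A AE] i : exists A, measurable A /\ f i = \1_A.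
    by have [A mA fE] := fA i (leq0n i); exists A.
  have mA i : measurable (A i) by case: (AE i).
  have mXA i : measurable (X i @^-1` A i).
    by rewrite -[_ @^-1` _]setTI; apply: measurable_funP.
  have fE i : f i = \1_(A i) by case: (AE i).
  have mE i : (m i)%:E = P (X i @^-1` A i).
    by rewrite lawX// -fm fE integral_indic// setIT.
  pose J := [fset i | i in iota 0 n]%fset.
  have inJ i : (i \in J) = (i < n)%N.
    apply/idP/idP => [/imfsetP[j /=]|ilt].
      by rewrite mem_iota add0n => /andP[_ jn] ->.
    by apply/imfsetP; exists i => //=; rewrite mem_iota.
  have /(_ J A) := indepX; move=> /(_ (fun j _ => mA j)) PJ.
  transitivity (P (\bigcap_(j in [set` J]) (X j @^-1` A j))).
    rewrite -[X in P X]setIT -integral_indic//; last first.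
      by apply: fin_bigcap_measurable => [|i _]; [exact: finite_fset|exact: mXA].
    apply: eq_integral => w _; congr EFin.
    rewrite indicE; have [/set_mem wJ|wJ] := boolP (_ \in _).
      rewrite big1// => i _; rewrite fE indicE mem_set//.
      by apply: (wJ i); rewrite /= inJ.
    have /existsP[i wi] : [exists i : 'I_n, X i w \notin A i].
      apply: contraNT wJ => /existsPn wA; rewrite inE => j /=; rewrite inJ => jn.
      by have := wA (Ordinal jn); rewrite negbK inE.
    by rewrite (bigD1 i)//= fE indicE (negbTE wi) mul0r.
  rewrite PJ; under eq_bigr do rewrite -mE.
  rewrite prodEFin; congr EFin.
  rewrite (perm_big (index_iota 0 n)) /=; last first.
    apply: uniq_perm; rewrite ?iota_uniq ?fset_uniq// => i.
    by rewrite mem_index_iota leq0n /= -inJ.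
  by rewrite big_mkord.
(* The family [g A] has an indicator in place [k], so the induction hypothesis covers it. *)
pose g A i : R -> R := if i == k then \1_A else f i.
have [nk|kn] := leqP n k.
  have gf (i : 'I_n) : g setT i = f i by rewrite /g ltn_eqF// (leq_trans _ nk).
  have := IHk (g setT) (fun i => if i == k then 1 else m i) _ _ _ _.
  under eq_integral do under eq_bigr do rewrite gf.
  under [in RHS]eq_bigr => i _ do rewrite ltn_eqF ?(leq_trans _ nk)//.
  apply.
  - by move=> i; rewrite /g; case: ifP => // _.
  - by move=> i x; rewrite /g; case: ifP.
  - move=> i; rewrite /g; case: ifP => // _.
    by rewrite integral_indic// setIT; exact: probability_setT.
  - move=> i; rewrite leq_eqVlt /g eq_sym => /predU1P[->|ki].
      by rewrite eqxx; exists setT.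
    by rewrite gtn_eqF//; apply: fA.
pose kO := Ordinal kn.
pose h w := \prod_(i < n | i != kO) f i (X i w).
pose c := \prod_(i < n | i != kO) m i.
have m0 i : 0 <= m i by rewrite -lee_fin -fm integral_ge0// => x _; rewrite lee_fin.
have c0 : 0 <= c by apply: prodr_ge0.
(* Weighted by the other factors, the law of [X k] is [nu] scaled by the constant [c]. *)
have hE A : measurable A ->
    (\int[P]_w (h w * \1_A (X k w))%:E = mscale (NngNum c0) nu A)%E.
  move=> mA.
  have nuA : (nu A = (fine (nu A))%:E)%E by rewrite fineK// fin_num_measure.
  have := IHk (g A) (fun i => if i == k then fine (nu A) else m i) _ _ _ _.
  rewrite (bigD1 kO)//= eqxx.
  under [in RHS]eq_bigr => i ik do [rewrite ifF; last exact/negbTE].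
  move=> H; transitivity (((fine (nu A))%:E * c%:E)%E); last first.
    by rewrite /mscale/= -nuA muleC.
  rewrite -EFinM -H.
  - apply: eq_integral => w _; congr EFin.
    rewrite (bigD1 kO)//= mulrC /g eqxx; congr (_ * _).
    apply: eq_bigr => i ik; rewrite ifF//; exact/negbTE.
  - by move=> i; rewrite /g; case: ifP => // _.
  - by move=> i x; rewrite /g; case: ifP.
  - move=> i; rewrite /g; case: ifP => // _.
    by rewrite integral_indic// setIT.
  - move=> i; rewrite leq_eqVlt /g eq_sym => /predU1P[->|ki].
      by rewrite eqxx; exists A.
    by rewrite gtn_eqF//; apply: fA.
have mh : measurable_fun setT h.
  rewrite (_ : h = fun w =>
      \prod_(i < n) (if i != kO then f i (X i w) else 1)); last first.
    by apply/funext => w; rewrite /h big_mkcond.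
  apply: measurable_prod => i _ /=; case: (i != kO) => //.
  by apply: measurableT_comp.
have h0 w : 0 <= h w by apply: prodr_ge0.
transitivity (\int[P]_w ((h w)%:E * (EFin \o f k) (X k w)))%E.
  apply: eq_integral => w _; rewrite -EFinM (bigD1 kO)//=.
  by rewrite [X in _ = X%:E]mulrC.
rewrite (weighted_transfer mh h0 _ hE)//; last 2 first.
- exact/measurable_EFinP.
- by move=> x; rewrite /= lee_fin.
rewrite ge0_integral_mscale//=; last 2 first.
- exact/measurable_EFinP.
- by move=> x _; rewrite lee_fin.
by rewrite fm (bigD1 kO)//= -EFinM mulrC.
Qed.

Lemma integral_prod_independent n (f : nat -> R -> R) (m : nat -> R) :
  (forall i, measurable_fun setT (f i)) -> (forall i x, 0 <= f i x) ->
  (forall i, (\int[nu]_x (f i x)%:E = (m i)%:E)%E) ->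
  (\int[P]_w (\prod_(i < n) f i (X i w))%:E = (\prod_(i < n) m i)%:E)%E.
Proof.
move=> mf f0 fm.
(* Beyond the first [n] places the functions become the constant 1, an indicator, as
   [hybrid_product] with [k = n] demands. *)
pose g i : R -> R := if (i < n)%N then f i else \1_setT.
have := @hybrid_product n n g (fun i => if (i < n)%N then m i else 1) _ _ _ _.
under eq_integral do under eq_bigr do rewrite /g ltn_ord.
under [in RHS]eq_bigr do rewrite ltn_ord.
apply.
- by move=> i; rewrite /g; case: ifP.
- by move=> i x; rewrite /g; case: ifP.
- move=> i; rewrite /g; case: ifP => // _.
  by rewrite integral_indic// setIT; exact: probability_setT.
- by move=> i; rewrite leqNgt /g => /negbTE ->; exists setT.
Qed.

End independent_product.

(** * Chebyshev's inequality and event bounds under a product density *)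

Section weighted_chebyshev.
Context (R : realType) (disp : measure_display) (T : measurableType disp)
  (P : probability T R) (X : nat -> {RV P >-> R}) (nu : probability R R).
Hypothesis indepX : mutually_independent X.
Hypothesis lawX : forall i A, measurable A -> P (X i @^-1` A) = nu A.
Context (L : R -> R) (Y : nat -> R -> R) (m v : nat -> R).
Hypotheses (mL : measurable_fun setT L) (L0 : forall x, 0 <= L x)
  (L1 : (\int[nu]_x (L x)%:E = 1)%E).
Hypotheses (mY : forall i, measurable_fun setT (Y i))
  (Y0 : forall i x, 0 <= Y i x).
Hypothesis mean : forall i, (\int[nu]_x (L x * Y i x)%:E = (m i)%:E)%E.
Hypothesis second_moment :
  forall i, (\int[nu]_x (L x * Y i x ^+ 2)%:E = (v i)%:E)%E.

Definition product_weight n w := \prod_(i < n) L (X i w).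
Let W := product_weight.
Let S n w := \sum_(i < n) Y i (X i w).
Let M n := \sum_(i < n) m i.

Lemma measurable_product_weight n : measurable_fun setT (W n).
Proof. by apply: measurable_prod => i _; apply: measurableT_comp. Qed.

Let mS n : measurable_fun setT (S n).
Proof. by apply: measurable_sum => i; apply: measurableT_comp. Qed.

Lemma product_weight_ge0 n w : 0 <= W n w.
Proof. exact: prodr_ge0. Qed.

Lemma integral_product_weight n : (\int[P]_w (W n w)%:E = 1)%E.
Proof.
rewrite (@integral_prod_independent _ _ _ _ _ nu indepX lawX n
  (fun=> L) (fun=> 1))//.
by rewrite big1.
Qed.

(** A function of one coordinate is a product over all coordinates with factors 1 elsewhere. First
    and mixed second moments thus become instances of [integral_prod_independent]. *)
Let prod_at n (j : 'I_n) (g : nat -> R) :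
  \prod_(i < n) (if i == j then g i else 1) = g j.
Proof. by rewrite -big_mkcond/= big_pred1_eq. Qed.

Let mean_W n (j : 'I_n) : (\int[P]_w (W n w * Y j (X j w))%:E = (m j)%:E)%E.
Proof.
pose f i x := L x * (if i == j :> nat then Y i x else 1).
pose mf i := if i == j :> nat then m i else 1.
have := @integral_prod_independent _ _ _ _ _ nu indepX lawX n f mf.
under eq_integral do rewrite big_split/= (prod_at j (fun i => Y i (X i _))).
rewrite (prod_at j m); apply.
- by move=> i; rewrite /f; apply: measurable_funM => //; case: (_ == _).
- by move=> i x; rewrite /f mulr_ge0//; case: ifP.
- move=> i; rewrite /f /mf; case: ifP => // _.
  by under eq_integral do rewrite mulr1.
Qed.

Let cross_W n (j k : 'I_n) :
  (\int[P]_w (W n w * (Y j (X j w) * Y k (X k w)))%:E =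
   (if j == k then v j else m j * m k)%:E)%E.
Proof.
pose f i x := L x * ((if i == j :> nat then Y i x else 1) *
                     (if i == k :> nat then Y i x else 1)).
pose mf i := if i == j :> nat then (if i == k :> nat then v i else m i)
             else (if i == k :> nat then m i else 1).
have -> : (if j == k then v j else m j * m k) = \prod_(i < n) mf i.
  have [jk|jk] := eqVneq j k.
    rewrite jk -(prod_at k v); apply: eq_bigr => i _; rewrite /mf jk.
    by rewrite -val_eqE/=; case: ifP.
  rewrite -(prod_at j m) -(prod_at k m) -big_split/=; apply: eq_bigr => i _.
  rewrite /mf -!val_eqE/=; have [ij|_] := eqVneq (i : nat) j; last first.
    by rewrite mul1r.
  by rewrite ij (negbTE (jk : j != k :> nat)) mulr1.
have := @integral_prod_independent _ _ _ _ _ nu indepX lawX n f mf.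
under eq_integral do rewrite !big_split/=
  (prod_at j (fun i => Y i (X i _))) (prod_at k (fun i => Y i (X i _))).
apply.
- move=> i; rewrite /f; apply: measurable_funM => //.
  by apply: measurable_funM; case: (_ == _).
- by move=> i x; rewrite /f !mulr_ge0//; case: ifP.
- move=> i; rewrite /f /mf; case: ifP => _; case: ifP => _.
  + exact: second_moment.
  + by under eq_integral do rewrite mulr1.
  + by under eq_integral do rewrite mul1r.
  + by under eq_integral do rewrite !mulr1.
Qed.

Let mWYY n (i j : 'I_n) :
  measurable_fun setT (fun w => W n w * (Y i (X i w) * Y j (X j w))).
Proof.
apply: measurable_funM; first exact: measurable_product_weight.
by apply: measurable_funM; apply: measurableT_comp.
Qed.

Let m_ge0 i : 0 <= m i.
Proof.
rewrite -lee_fin -mean; apply: integral_ge0 => x _.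
by rewrite lee_fin mulr_ge0.
Qed.

(** The density [W] has total mass 1 and makes the coordinates independent with density [L] against
    [nu], so the variances [v i - m i ^+ 2] of the summands add up. *)
Lemma variance_product_weight n :
  (\int[P]_w (W n w * (S n w - M n) ^+ 2)%:E =
   (\sum_(i < n) (v i - m i ^+ 2))%:E)%E.
Proof.
have W0 := product_weight_ge0 n; have mW := measurable_product_weight n.
have S0 w : 0 <= S n w by apply: sumr_ge0.
have M0 : 0 <= M n by apply: sumr_ge0.
have WS : (\int[P]_w (W n w * S n w)%:E = (M n)%:E)%E.
  under eq_integral do rewrite mulr_sumr -sumEFin.
  rewrite ge0_integral_sum//.
  - by under eq_bigr do rewrite mean_W; rewrite sumEFin.
  - move=> i; apply/measurable_EFinP/measurable_funM => //.
    exact: measurableT_comp.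
  - by move=> i w _; rewrite lee_fin mulr_ge0.
have WSS : (\int[P]_w (W n w * S n w ^+ 2)%:E =
    (\sum_(i < n) (v i - m i ^+ 2) + M n ^+ 2)%:E)%E.
  transitivity (\int[P]_w (\sum_(i < n) \sum_(j < n)
      (W n w * (Y i (X i w) * Y j (X j w)))%:E))%E.
    apply: eq_integral => w _; rewrite expr2 {1}/S mulr_suml mulr_sumr -sumEFin.
    apply: eq_bigr => i _; rewrite sumEFin; congr EFin.
    by rewrite /S mulr_sumr mulr_sumr.
  rewrite ge0_integral_sum//=; last 2 first.
  - move=> i; apply: emeasurable_sum => j; exact/measurable_EFinP/mWYY.
  - by move=> i w _; apply: sume_ge0 => j _; rewrite lee_fin !mulr_ge0.
  under eq_bigr => i _.
    rewrite ge0_integral_sum//=; last 2 first.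
    + by move=> j; exact/measurable_EFinP/mWYY.
    + by move=> j w _; rewrite lee_fin !mulr_ge0.
    under eq_bigr do rewrite cross_W.
    rewrite sumEFin (bigD1 i)//= eqxx.
    have -> : \sum_(j < n | j != i) (if i == j then v i else m i * m j) =
        m i * M n - m i ^+ 2.
      rewrite /M [X in m i * X](bigD1 i)//= mulrDr expr2 addrAC subrr add0r.
      rewrite mulr_sumr; apply: eq_bigr => j ji.
      by rewrite eq_sym (negbTE ji).
    over.
  rewrite sumEFin; congr EFin.
  rewrite (eq_bigr (fun i : 'I_n => (v i - m i ^+ 2) + m i * M n)); last first.
    by move=> i _; ring.
  by rewrite big_split/= -mulr_suml expr2.
have mD : measurable_fun setT (fun w => W n w * (S n w - M n) ^+ 2).
  apply: measurable_funM => //; apply: measurable_funX.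
  by apply: measurable_funB => //; exact: mS.
(* The square is expanded with the negative cross term moved to the left. Every integrand is then
   nonnegative, and no integrability has to be shown. *)
have H : (\int[P]_w (W n w * (S n w - M n) ^+ 2)%:E +
    (2 * M n)%:E * \int[P]_w (W n w * S n w)%:E =
    \int[P]_w (W n w * S n w ^+ 2)%:E +
    (M n ^+ 2)%:E * \int[P]_w (W n w)%:E)%E.
  have mWS : measurable_fun setT (fun w => (W n w * S n w)%:E).
    by apply/measurable_EFinP/measurable_funM => //; exact: mS.
  have mWSS : measurable_fun setT (fun w => (W n w * S n w ^+ 2)%:E).
    apply/measurable_EFinP/measurable_funM => //.
    by apply: measurable_funX; exact: mS.
  rewrite -!ge0_integralZl_EFin//; last 5 first.
  - by move=> w _; rewrite lee_fin.
  - exact/measurable_EFinP.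
  - exact: sqr_ge0.
  - by move=> w _; rewrite lee_fin mulr_ge0.
  - by rewrite mulr_ge0.
  rewrite -!ge0_integralD//; last 7 first.
  - by move=> w _; rewrite lee_fin mulr_ge0// sqr_ge0.
  - by move=> w _; rewrite -EFinM lee_fin mulr_ge0// sqr_ge0.
  - by apply: measurable_funeM; exact/measurable_EFinP.
  - by move=> w _; rewrite lee_fin mulr_ge0// sqr_ge0.
  - exact/measurable_EFinP.
  - by move=> w _; rewrite -EFinM lee_fin !mulr_ge0.
  - exact: measurable_funeM.
  apply: eq_integral => w _; rewrite -!EFinM -!EFinD; congr EFin; ring.
move: H; rewrite WS WSS integral_product_weight mule1 -EFinM -EFinD => H.
rewrite -[LHS](@addeK _ (2 * M n * M n)%:E)// H -EFinB.
by congr EFin; ring.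
Qed.

Lemma weighted_chebyshev n (B : set T) (a : R) : measurable B ->
  (forall w, B w -> a <= (S n w - M n) ^+ 2) ->
  (a%:E * \int[P]_w (W n w * \1_B w)%:E <=
    (\sum_(i < n) (v i - m i ^+ 2))%:E)%E.
Proof.
move=> mB Ba; have W0 := product_weight_ge0 n.
have mW := measurable_product_weight n.
have mWB : measurable_fun setT (fun w => (W n w * \1_B w)%:E).
  by apply/measurable_EFinP/measurable_funM.
rewrite -variance_product_weight.
have [a0|a0] := leP 0 a; last first.
  apply: (@le_trans _ _ 0%E).
    apply: mule_le0_ge0; first by rewrite lee_fin ltW.
    by apply: integral_ge0 => w _; rewrite lee_fin mulr_ge0.
  by apply: integral_ge0 => w _; rewrite lee_fin mulr_ge0// sqr_ge0.
rewrite -ge0_integralZl_EFin//; last first.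
  by move=> w _; rewrite lee_fin mulr_ge0.
apply: ge0_le_integral => //.
- by move=> w _; rewrite lee_fin !mulr_ge0.
- exact: measurable_funeM.
- apply/measurable_EFinP; apply: measurable_funM => //; apply: measurable_funX.
  by apply: measurable_funB => //; exact: mS.
- move=> w _; rewrite -EFinM lee_fin mulrCA ler_wpM2l// indicE.
  have [/set_mem/Ba|_] := boolP (w \in B); first by rewrite mulr1.
  by rewrite mulr0 sqr_ge0.
Qed.

(* [W <= W^2/(4K) + K] on [A]; elsewhere the weighted Chebyshev bound. *)
Lemma tilted_lower_bound n (A : set T) (a l K : R) : measurable A ->
  (forall w, ~ A w -> a <= (S n w - M n) ^+ 2) -> 0 < a -> 0 < K ->
  (\int[nu]_x (L x ^+ 2)%:E = l%:E)%E -> l ^+ n <= K ->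
  1 <= (\sum_(i < n) (v i - m i ^+ 2)) / a + 4^-1 + K * fine (P A).
Proof.
move=> mA Aa a0 K0 lE lK.
have W0 := product_weight_ge0 n; have mW := measurable_product_weight n.
have mWB (B : set T) : measurable B ->
    measurable_fun setT (fun w => (W n w * \1_B w)%:E).
  by move=> mB; apply/measurable_EFinP/measurable_funM.
have mAC : measurable (~` A) by exact: measurableC.
have split1 : (1 = \int[P]_w (W n w * \1_(~` A) w)%:E +
    \int[P]_w (W n w * \1_A w)%:E)%E.
  rewrite -ge0_integralD//; last 4 first.
  - by move=> w _; rewrite lee_fin mulr_ge0.
  - exact: mWB.
  - by move=> w _; rewrite lee_fin mulr_ge0.
  - exact: mWB.
  rewrite -(integral_product_weight n); apply: eq_integral => w _.
  by rewrite -EFinD -mulrDr !indicE in_setC; case: (w \in A);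
    rewrite /= ?addr0 ?add0r mulr1.
(* The second moment of the likelihood ratio factorises over the coordinates. *)
have W2 : (\int[P]_w (W n w ^+ 2)%:E = (l ^+ n)%:E)%E.
  under eq_integral do rewrite -prodrXl.
  rewrite (@integral_prod_independent _ _ _ _ _ nu indepX lawX n
    (fun _ x => L x ^+ 2) (fun=> l))//.
  - by rewrite prodr_const card_ord.
  - by move=> i; apply: measurable_funX.
  - by move=> i x; rewrite sqr_ge0.
have WA : (\int[P]_w (W n w * \1_A w)%:E <= (4^-1 + K * fine (P A))%:E)%E.
  apply: (@le_trans _ _ (\int[P]_w
      (((4 * K)^-1)%:E * (W n w ^+ 2)%:E + K%:E * (\1_A w)%:E)%E)%E).
    apply: ge0_le_integral => //.
    - by move=> w _; rewrite lee_fin mulr_ge0.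
    - exact: mWB.
    - apply: emeasurable_funD; apply: measurable_funeM; apply/measurable_EFinP.
        exact: measurable_funX.
      exact: measurable_indic.
    move=> w _; rewrite -!EFinM -EFinD lee_fin indicE.
    case: (w \in A) => /=; last first.
      by rewrite !mulr0 addr0 mulr_ge0 ?sqr_ge0// invr_ge0 mulr_ge0// ltW.
    rewrite !mulr1 -subr_ge0.
    have -> : (4 * K)^-1 * W n w ^+ 2 + K - W n w =
        (4 * K)^-1 * (W n w - 2 * K) ^+ 2 by field; rewrite gt_eqF.
    by rewrite mulr_ge0 ?sqr_ge0// invr_ge0 mulr_ge0// ltW.
  rewrite ge0_integralD//; last 4 first.
  - move=> w _; rewrite lee_fin mulr_ge0 ?sqr_ge0// invr_ge0 mulr_ge0// ltW//.
  - by apply: measurable_funeM; apply/measurable_EFinP/measurable_funX.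
  - by move=> w _; rewrite lee_fin mulr_ge0// ltW.
  - by apply: measurable_funeM; apply/measurable_EFinP/measurable_indic.
  rewrite !ge0_integralZl_EFin//; last 5 first.
  - exact/measurable_EFinP/measurable_indic.
  - exact: ltW.
  - by move=> w _; rewrite lee_fin sqr_ge0.
  - exact/measurable_EFinP/measurable_funX.
  - by rewrite invr_ge0 mulr_ge0// ltW.
  have PA : P A = (fine (P A))%:E by rewrite fineK// fin_num_measure.
  rewrite W2 integral_indic// setIT [X in (K%:E * X)%E]PA.
  rewrite -!EFinM -EFinD lee_fin lerD2r invfM -mulrA ler_piMr//.
  by rewrite ler_pdivrMl// mulr1.
have := @weighted_chebyshev n (~` A) a mAC Aa.
(* The bounds by 0 and 1 exclude infinite values, so that the rest is arithmetic in [R]. *)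
have : (\int[P]_w (W n w * \1_(~` A) w)%:E <= 1)%E.
  by rewrite [leRHS]split1 leeDl// integral_ge0// => w _; rewrite lee_fin mulr_ge0.
have : (0 <= \int[P]_w (W n w * \1_(~` A) w)%:E)%E.
  by rewrite integral_ge0// => w _; rewrite lee_fin mulr_ge0.
move: split1; case: (\int[P]_w (W n w * \1_(~` A) w)%:E)%E => // r.
move: WA; case: (\int[P]_w (W n w * \1_A w)%:E)%E => [s| |] //.
rewrite lee_fin => sK; rewrite -EFinD => -[rs] _ _.
rewrite -EFinM lee_fin => ar.
rewrite [leLHS]rs -addrA lerD// ler_pdivlMr// mulrC//.
Qed.

End weighted_chebyshev.

(** * Power inequalities and functions of at most exponential growth *)

Section exp_bounded.
Context (R : realType).
Implicit Types f g : R -> R.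

Lemma one_powR (q : R) : 1 `^ q = 1 :> R. Proof. by rewrite powR1. Qed.

Lemma powR_ge1 (x q : R) : 0 <= q -> 1 <= x -> 1 <= x `^ q.
Proof.
move=> q0 x1; rewrite -(one_powR q) ge0_ler_powR ?nnegrE//.
exact: le_trans x1.
Qed.

Lemma powR_le1 (x q : R) : 0 <= q -> 0 <= x -> x <= 1 -> x `^ q <= 1.
Proof. by move=> q0 x0 x1; rewrite -(one_powR q) ge0_ler_powR ?nnegrE. Qed.

(** With [(1 + d) ^ q = 1 + e], either [b <= d * a] and the sum is at most [(1 + d) * a], or
    [a < b / d] and it is at most a multiple of [b]. A leading coefficient close to 1 later lets the
    main terms of a second moment and of a squared mean nearly cancel. *)
Lemma powRD_le (q e : R) : 0 < q -> 0 < e -> exists C, 0 <= C /\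
  forall a b : R, 0 <= a -> 0 <= b ->
    (a + b) `^ q <= (1 + e) * a `^ q + C * b `^ q.
Proof.
move=> q0 e0; pose d := (1 + e) `^ q^-1 - 1.
have e1 : 0 <= 1 + e by rewrite addr_ge0// ltW.
have dE : (1 + d) `^ q = 1 + e.
  by rewrite /d addrC subrK -powRrM mulVf ?gt_eqF// powRr1.
have d0 : 0 < d.
  rewrite /d subr_gt0 -[ltLHS](one_powR q^-1).
  by rewrite gt0_ltr_powR ?invr_gt0 ?nnegrE// ltrDl.
have d1 : 0 <= 1 + d by rewrite addr_ge0// ltW.
have dV : 0 <= d^-1 + 1 by rewrite addr_ge0// invr_ge0 ltW.
exists ((d^-1 + 1) `^ q); split; first exact: powR_ge0.
move=> a b a0 b0; have [ba|ab] := leP b (d * a).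
  apply: (@le_trans _ _ (((1 + d) * a) `^ q)); last first.
    by rewrite powRM// dE lerDl mulr_ge0// powR_ge0.
  apply: ge0_ler_powR; rewrite ?nnegrE ?(ltW q0) ?addr_ge0 ?mulr_ge0//.
  by rewrite mulrDl mul1r lerD2l.
apply: (@le_trans _ _ (((d^-1 + 1) * b) `^ q)); last first.
  by rewrite powRM// lerDr mulr_ge0// powR_ge0.
apply: ge0_ler_powR; rewrite ?nnegrE ?(ltW q0) ?addr_ge0 ?mulr_ge0//.
by rewrite mulrDl mul1r lerD2r -ler_pdivrMl ?invr_gt0// invrK ltW.
Qed.

(** A class stable under sums, products and reflection whose members are all integrable for the
    Gaussian law. It contains the shifted powers, the exponentials and the indicators that occur
    below. *)
Definition exp_bounded f := measurable_fun setT f /\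
  exists C a, [/\ 0 <= C, 0 <= a & forall x, `|f x| <= C * expR (a * `|x|)].

Lemma exp_bounded_bounded f (C : R) :
  measurable_fun setT f -> (forall x, `|f x| <= C) -> exp_bounded f.
Proof.
move=> mf fC; split => //; exists C, 0; split => //.
  by rewrite (le_trans _ (fC 0)).
by move=> x; rewrite mul0r expR0 mulr1.
Qed.

Lemma exp_bounded_cst (c : R) : exp_bounded (fun=> c).
Proof. exact: (@exp_bounded_bounded _ `|c|). Qed.

Lemma exp_bounded_indic (A : set R) : measurable A -> exp_bounded \1_A.
Proof.
move=> mA; apply: (@exp_bounded_bounded _ 1) => // x.
by rewrite indicE; case: (_ \in _); rewrite ?normr1 ?normr0.
Qed.

Lemma exp_boundedM f g : exp_bounded f -> exp_bounded g ->
  exp_bounded (fun x => f x * g x).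
Proof.
move=> [mf [C [a [C0 a0 fC]]]] [mg [D [b [D0 b0 gD]]]].
split; first exact: measurable_funM.
exists (C * D), (a + b); split; rewrite ?mulr_ge0 ?addr_ge0// => x.
by rewrite normrM mulrDl expRD mulrACA ler_pM.
Qed.

Lemma exp_boundedD f g : exp_bounded f -> exp_bounded g ->
  exp_bounded (fun x => f x + g x).
Proof.
move=> [mf [C [a [C0 a0 fC]]]] [mg [D [b [D0 b0 gD]]]].
split; first exact: measurable_funD.
exists (C + D), (a + b); split; rewrite ?addr_ge0// => x.
rewrite (le_trans (ler_normD _ _))// mulrDl lerD//.
  rewrite (le_trans (fC x))// ler_wpM2l// ler_expR mulrDl lerDl mulr_ge0//.
by rewrite (le_trans (gD x))// ler_wpM2l// ler_expR mulrDl lerDr mulr_ge0.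
Qed.

Lemma exp_bounded_id : exp_bounded id.
Proof.
split; first exact: measurable_id.
exists 1, 1; split => // x; rewrite !mul1r.
by rewrite (le_trans _ (expR_ge1Dx _))// lerDr.
Qed.

Lemma exp_bounded_opp f : exp_bounded f -> exp_bounded (fun x => f (- x)).
Proof.
move=> [mf [C [a [C0 a0 fC]]]]; split.
  by apply: measurableT_comp => //; exact: oppr_measurable.
by exists C, a; split => // x; rewrite -(normrN x).
Qed.

Lemma exp_bounded_expR (t : R) : exp_bounded (fun x => expR (t * x)).
Proof.
split; first by apply: measurableT_comp.
exists 1, `|t|; split => // x.
by rewrite mul1r ger0_norm ?expR_ge0// ler_expR -normrM ler_norm.
Qed.

Lemma exp_bounded_expR_norm : exp_bounded (fun x => expR `|x|).
Proof.
split; first by apply: measurableT_comp => //; exact: normr_measurable.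
exists 1, 1; split => // x.
by rewrite !mul1r ger0_norm ?expR_ge0.
Qed.

Lemma powR_le_expR (x q : R) : 0 <= x -> 0 <= q -> x `^ q <= expR (q * x).
Proof.
move=> x0 q0; rewrite mulrC expRM ge0_ler_powR ?nnegrE ?expR_ge0//.
by rewrite (le_trans _ (expR_ge1Dx _))// lerDr.
Qed.

Lemma exp_bounded_powR (t q : R) : 0 <= q ->
  exp_bounded (fun x => `|t + x| `^ q).
Proof.
move=> q0; split.
  apply: (measurableT_comp (measurable_powR _)).
  apply: measurableT_comp; first exact: normr_measurable.
  exact: measurable_funD.
exists (expR (q * `|t|)), q; split; rewrite ?expR_ge0// => x.
rewrite ger0_norm ?powR_ge0// (le_trans (powR_le_expR _ _))//.
by rewrite -expRD ler_expR -mulrDr ler_wpM2l// ler_normD.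
Qed.

End exp_bounded.

(** This is the function [w] of the overview: near 0 a shift acts only at second order, because the
    first-order term is odd, and far away it acts like [|t| ^ p]. *)
Definition local_power (R : realType) (p t : R) : R :=
  if `|t| <= 1 then t ^+ 2 else `|t| `^ p.

(** * Absolute moments of the shifted standard normal law *)

Section standard_gaussian.
Context (R : realType) (gam : probability R R).
Hypothesis gamE : forall A, measurable A -> gam A = normal_prob 0 1 A.

Let pdf : R -> R := normal_pdf 0 1.

Let pdfE x : pdf x = normal_peak 1 * expR (- x ^+ 2 / 2).
Proof. by rewrite /pdf normal_pdfE ?oner_neq0// /normal_fun subr0 expr1n. Qed.

Let integral_density (f : R -> R) : measurable_fun setT f ->
  (forall x, 0 <= f x) ->
  (\int[gam]_x (f x)%:E = \int[lebesgue_measure]_x (pdf x * f x)%:E)%E.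
Proof.
move=> mf f0.
have mid : measurable_fun setT (idfun : measurableTypeR R -> R).
  exact: measurable_id.
have mpdf : measurable_fun [set: measurableTypeR R] pdf.
  exact: measurable_normal_pdf.
have H A : measurable A ->
    (\int[lebesgue_measure]_x (pdf x * \1_A (x : R))%:E = gam A)%E.
  move=> mA; rewrite gamE// /normal_prob [RHS]integral_mkcond.
  by apply: eq_integral => x _; rewrite epatch_indic EFinM.
have := weighted_transfer mpdf (normal_pdf_ge0 _ _) mid H (f := EFin \o f).
move=> <- //.
by apply/measurable_EFinP.
Qed.

Let lebesgue_shift (t : R) (g : R -> \bar R) : measurable_fun setT g ->
  (forall x, 0 <= g x)%E ->
  (\int[lebesgue_measure]_x g (t + x)%R = \int[lebesgue_measure]_x g x)%E.
Proof.
move=> mg g0.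
pose phi : measurableTypeR R -> measurableTypeR R := fun x => t + x.
have mphi : measurable_fun setT phi by exact: measurable_funD.
transitivity (\int[pushforward lebesgue_measure phi]_x g x)%E.
  by rewrite ge0_integral_pushforward.
apply: eq_measure_integral => A mA _.
apply/esym/lebesgue_measure_unique => //= _ [[a b]] _ <-.
rewrite /pushforward.
have -> : phi @^-1` `]a, b] = `]a - t, b - t]%classic.
  apply/seteqP; split => x; rewrite /phi /= !in_itv/= ltrBlDl lerBrDl//.
by rewrite !lebesgue_measure_itv/= !lte_fin ltrD2r -!EFinB; congr (if _ then _%:E else _); ring.
Qed.

(** Translation invariance of Lebesgue measure moves the shift into the density, and [pdf (x - t) =
    pdf x * exp (t x - t^2 / 2)]. *)
Lemma gauss_shift (f : R -> R) (t : R) : measurable_fun setT f ->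
  (forall x, 0 <= f x) ->
  (\int[gam]_x (f (t + x))%:E =
   \int[gam]_x (f x * expR (t * x - t ^+ 2 / 2))%:E)%E.
Proof.
move=> mf f0.
have mt : measurable_fun setT (fun x => f (t + x)).
  by apply: (measurableT_comp mf); exact: measurable_funD.
have me : measurable_fun setT (fun x : R => expR (t * x - t ^+ 2 / 2)).
  by apply: measurableT_comp => //; exact: measurable_funB.
rewrite !integral_density//; last 2 first.
- exact: measurable_funM.
- by move=> x; rewrite mulr_ge0 ?expR_ge0.
pose g y := (pdf (y - t) * f y)%:E.
transitivity (\int[lebesgue_measure]_x g (t + x)%R)%E.
  by apply: eq_integral => x _; rewrite /g [t + x]addrC addrK.
rewrite lebesgue_shift//; last 2 first.
- apply/measurable_EFinP/measurable_funM => //.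
  apply: (measurableT_comp (measurable_normal_pdf _ _)).
  exact: measurable_funB.
- by move=> x; rewrite lee_fin mulr_ge0// normal_pdf_ge0.
apply: eq_integral => x _; rewrite /g !pdfE; congr EFin.
rewrite -!mulrA; congr (_ * _); rewrite mulrCA -expRD mulrC; congr (_ * expR _).
by field.
Qed.

(** The moment generating function comes for free: [gauss_shift] for the constant 1 says that
    [exp (a x - a^2 / 2)] has integral 1. *)
Let expR_integrable (a : R) :
  (\int[gam]_x (expR (a * x))%:E = (expR (a ^+ 2 / 2))%:E)%E.
Proof.
have H : (1 = (expR (- (a ^+ 2 / 2)))%:E * \int[gam]_x (expR (a * x))%:E)%E.
  rewrite -ge0_integralZl_EFin ?expR_ge0//; last first.
    by apply/measurable_EFinP; apply: measurableT_comp.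
  transitivity (\int[gam]_x (1%R)%:E)%E.
    by rewrite integral_cst// mul1e; exact/esym/probability_setT.
  rewrite (@gauss_shift (fun=> 1) a)//.
  by apply: eq_integral => x _; rewrite mul1r addrC expRD EFinM.
move: H; rewrite expRN => H.
have := congr1 (mule (expR (a ^+ 2 / 2))%:E) H.
by rewrite mule1 muleA -EFinM mulfV ?expR_eq0// mul1e => <-.
Qed.

Lemma exp_bounded_integrable (f : R -> R) : exp_bounded f ->
  gam.-integrable setT (EFin \o f).
Proof.
move=> [mf [C [a [C0 a0 fC]]]].
apply/integrableP; split; first exact/measurable_EFinP.
have me b : measurable_fun setT (fun x : R => expR (b * x)).
  by apply: measurableT_comp.
apply: (@le_lt_trans _ _ (\int[gam]_x
    (C%:E * ((expR (a * x))%:E + (expR (- a * x))%:E))%E)%E).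
  apply: ge0_le_integral => //=.
  - by do 2 apply: measurableT_comp => //.
  - by apply: measurable_funeM; apply: emeasurable_funD; exact/measurable_EFinP.
  move=> x _; rewrite -EFinD -EFinM lee_fin (le_trans (fC x))// ler_wpM2l//.
  have [x0|x0] := leP 0 x.
    by rewrite ger0_norm// lerDl expR_ge0.
  by rewrite ltr0_norm// mulrN mulNr lerDr expR_ge0.
rewrite ge0_integralZl_EFin//; last 2 first.
- by move=> x _; rewrite -EFinD lee_fin addr_ge0 ?expR_ge0.
- by apply: emeasurable_funD; exact/measurable_EFinP.
rewrite ge0_integralD//; last 2 first.
- exact/measurable_EFinP.
- exact/measurable_EFinP.
by rewrite !expR_integrable -EFinD -EFinM ltry.
Qed.

Local Notation E := (Rintegral gam setT).

Lemma gauss_EFin f : exp_bounded f -> (\int[gam]_x (f x)%:E = (E f)%:E)%E.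
Proof.
move=> ef; rewrite /Rintegral fineK//.
exact/integrable_fin_num/exp_bounded_integrable.
Qed.

Lemma gauss_expectationD f g : exp_bounded f -> exp_bounded g ->
  E (fun x => f x + g x) = E f + E g.
Proof. by move=> ? ?; apply: RintegralD => //; exact: exp_bounded_integrable. Qed.

Lemma gauss_expectationZ c f : exp_bounded f -> E (fun x => c * f x) = c * E f.
Proof. by move=> ?; apply: RintegralZl => //; exact: exp_bounded_integrable. Qed.

Lemma gauss_expectation_cst c : E (fun=> c) = c.
Proof.
transitivity (c * fine (gam setT)); first exact: Rintegral_cst.
by rewrite probability_setT mulr1.
Qed.

Lemma gauss_expectation_le f g : exp_bounded f -> exp_bounded g ->
  (forall x, f x <= g x) -> E f <= E g.
Proof.
by move=> ? ? ?; apply: le_Rintegral => //; exact: exp_bounded_integrable.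
Qed.

Lemma gauss_expectation_ge0 f : (forall x, 0 <= f x) -> 0 <= E f.
Proof. by move=> f0; apply: Rintegral_ge0. Qed.

Lemma gauss_expectation_shift f t : exp_bounded f -> (forall x, 0 <= f x) ->
  E (fun x => f (t + x)) = expR (- (t ^+ 2 / 2)) * E (fun x => f x * expR (t * x)).
Proof.
move=> ef f0; rewrite -gauss_expectationZ; last first.
  by apply: exp_boundedM => //; exact: exp_bounded_expR.
rewrite /Rintegral gauss_shift//; last by case: ef.
by congr fine; apply: eq_integral => x _; rewrite addrC expRD mulrCA.
Qed.

Let gam_opp (A : set R) : measurable A -> gam ((-%R : R -> R) @^-1` A) = gam A.
Proof.
move=> mA.
have mA' : measurable ((-%R : R -> R) @^-1` A).
  by rewrite -[_ @^-1` _]setTI; exact: oppr_measurable.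
have gi (B : set R) : measurable B ->
    (gam B = \int[lebesgue_measure]_x (pdf x * \1_B x)%:E)%E.
  by move=> mB; rewrite -integral_density// integral_indic// setIT.
rewrite !gi//.
pose g (x : measurableTypeR R) := (pdf x * \1_A (x : R))%:E.
transitivity (\int[pushforward lebesgue_measure
    (-%R : measurableTypeR R -> measurableTypeR R)]_x g x)%E; last first.
  apply: eq_measure_integral => B mB _; exact: lebesgue_measureN.
rewrite ge0_integral_pushforward//.
- apply: eq_integral => x _; rewrite /g/= !pdfE sqrrN; congr (_ * _)%:E.
- apply/measurable_EFinP/measurable_funM; first exact: measurable_normal_pdf.
  exact: measurable_indic.
- by move=> x _; rewrite lee_fin mulr_ge0// normal_pdf_ge0.
Qed.

Lemma gauss_expectation_opp f : exp_bounded f -> E (fun x => f (- x)) = E f.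
Proof.
move=> ef; have [mf _] := ef.
have mN : measurable_fun setT (-%R : R -> R) by exact: oppr_measurable.
rewrite /Rintegral; congr fine.
transitivity (\int[pushforward gam (-%R : R -> R)]_x (f x)%:E)%E.
  rewrite integral_pushforward//; first exact/measurable_EFinP.
  exact: exp_bounded_integrable (exp_bounded_opp ef).
by apply: eq_measure_integral => A mA _; exact: gam_opp.
Qed.

Let mu q := E (fun x => `|x| `^ q).
Let A q t := E (fun x => `|t + x| `^ q).

Let eb_abs q : 0 <= q -> exp_bounded (fun x : R => `|x| `^ q).
Proof.
move=> q0; have := exp_bounded_powR 0 q0.
by under eq_fun do rewrite add0r.
Qed.

Lemma gauss_moment_shift_le (q e : R) : 0 < q -> 0 < e ->
  exists C, 0 <= C /\ forall t, A q t <= (1 + e) * `|t| `^ q + C.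
Proof.
move=> q0 e0; have [C [C0 CP]] := powRD_le q0 e0.
exists (C * mu q); split => [|t].
  by rewrite mulr_ge0// gauss_expectation_ge0// => x; exact: powR_ge0.
have eq0 := eb_abs (ltW q0).
rewrite -(gauss_expectation_cst ((1 + e) * _)) -gauss_expectationZ//.
rewrite -gauss_expectationD; [|exact: exp_bounded_cst|]; last first.
  by apply: exp_boundedM => //; exact: exp_bounded_cst.
apply: gauss_expectation_le.
- exact/exp_bounded_powR/ltW.
- apply: exp_boundedD; first exact: exp_bounded_cst.
  by apply: exp_boundedM => //; exact: exp_bounded_cst.
- move=> x; apply: le_trans (CP _ _ (normr_ge0 _) (normr_ge0 _)).
  by apply: ge0_ler_powR; rewrite ?nnegrE ?(ltW q0) ?addr_ge0// ler_normD.
Qed.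

(** For [y >= 0], the inequality [exp y * (1 - y) <= 1] is used twice. For [y < 0], it gives
    [exp y <= 1 / (1 - y) <= 1 + y + y^2]. *)
Let expR_quadratic_ub (y : R) : expR y <= 1 + y + y ^+ 2 * expR `|y|.
Proof.
have h1 : expR y * (1 - y) <= 1.
  by rewrite -ler_pdivlMl ?expR_gt0// mulr1 -expRN expR_ge1Dx.
have h2 := expR_ge1Dx y; have h3 := expR_gt0 y.
have [y0|y0] := leP 0 y.
  rewrite ger0_norm//; nra.
rewrite ltr0_norm//; have h4 : 1 <= expR (- y).
  by rewrite -expR0 ler_expR oppr_ge0 ltW.
have : y ^+ 2 <= y ^+ 2 * expR (- y) by rewrite ler_peMr// sqr_ge0.
nra.
Qed.

Let odd_moment q : 0 <= q -> E (fun x => `|x| `^ q * x) = 0.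
Proof.
move=> q0.
have ef : exp_bounded (fun x : R => `|x| `^ q * x).
  by apply: exp_boundedM; [exact: eb_abs|exact: exp_bounded_id].
have := gauss_expectation_opp ef.
under eq_Rintegral do rewrite normrN mulrN -mulN1r.
by rewrite gauss_expectationZ// => ?; lra.
Qed.

(** For [|t| <= 1] the shift becomes a factor [exp (t x)], expanded to second order; the linear term
    integrates to 0 by oddness and the remainder costs [t ^+ 2 * E f]. For [|t| > 1], where
    [|t| ^ p >= 1], the bound [2 |t| ^ p + D] suffices. *)
Lemma gauss_moment_shift_ub p : 0 < p ->
  exists C, 0 <= C /\ forall t, A p t <= mu p + C * local_power p t.
Proof.
move=> p0; have [D [D0 AD]] := gauss_moment_shift_le p0 ltr01.
pose f x : R := `|x| `^ p * (x ^+ 2 * expR `|x|).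
have ea := eb_abs (ltW p0).
have ef : exp_bounded f.
  apply: exp_boundedM => //; apply: exp_boundedM; last exact: exp_bounded_expR_norm.
  by apply: exp_boundedM; exact: exp_bounded_id.
have f0 x : 0 <= f x by rewrite /f mulr_ge0 ?powR_ge0// mulr_ge0 ?sqr_ge0 ?expR_ge0.
have Ef0 : 0 <= E f by apply: gauss_expectation_ge0.
have mu0 : 0 <= mu p by apply: gauss_expectation_ge0 => x; exact: powR_ge0.
exists (E f + (2 + D)); split; first by rewrite !addr_ge0.
move=> t; rewrite /local_power; case: ifPn => [t1|]; last first.
  rewrite -ltNge => t1.
  have tp1 : 1 <= `|t| `^ p.
    by rewrite powR_ge1 ?(ltW p0) ?(ltW t1).
  have := AD t; nra.
apply: (@le_trans _ _ (mu p + t ^+ 2 * E f)); last first.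
  by rewrite lerD2l mulrC ler_wpM2r ?sqr_ge0// lerDl addr_ge0.
have et : exp_bounded (fun x => `|x| `^ p * expR (t * x)).
  by apply: exp_boundedM => //; exact: exp_bounded_expR.
have -> : A p t =
    expR (- (t ^+ 2 / 2)) * E (fun x => `|x| `^ p * expR (t * x)).
  by apply: (gauss_expectation_shift t ea) => x; exact: powR_ge0.
apply: (@le_trans _ _ (E (fun x => `|x| `^ p * expR (t * x)))).
  rewrite ler_piMl//.
    by apply: gauss_expectation_ge0 => x; rewrite mulr_ge0 ?powR_ge0 ?expR_ge0.
  by rewrite expR_le1 oppr_le0 mulr_ge0// sqr_ge0.
have eo : exp_bounded (fun x : R => `|x| `^ p * x).
  by apply: exp_boundedM => //; exact: exp_bounded_id.
have eZ c g : exp_bounded g -> exp_bounded (fun x => c * g x).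
  by move=> eg; apply: exp_boundedM => //; exact: exp_bounded_cst.
have -> : mu p + t ^+ 2 * E f =
    E (fun x => `|x| `^ p + (t * (`|x| `^ p * x) + t ^+ 2 * f x)).
  rewrite gauss_expectationD//; last by apply: exp_boundedD; exact: eZ.
  rewrite gauss_expectationD; [|exact: eZ..].
  by rewrite !gauss_expectationZ// odd_moment ?(ltW p0)// mulr0 add0r.
apply: gauss_expectation_le => //.
  by apply: exp_boundedD => //; apply: exp_boundedD; exact: eZ.
move=> x; have -> : `|x| `^ p + (t * (`|x| `^ p * x) + t ^+ 2 * f x) =
    `|x| `^ p * (1 + t * x + (t * x) ^+ 2 * expR `|x|) by rewrite /f; ring.
rewrite ler_wpM2l ?powR_ge0// (le_trans (expR_quadratic_ub _))// lerD2l.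
by rewrite ler_wpM2l ?sqr_ge0// ler_expR normrM ler_piMl.
Qed.

Let gauss_itv_gt0 a b : a < b -> 0 < E \1_`[a, b].
Proof.
move=> ab.
rewrite -lte_fin -gauss_EFin; last exact: exp_bounded_indic.
(* A lower bound for the density on the interval, since [x ^+ 2 <= a ^+ 2 + b ^+ 2] there. *)
pose m := normal_peak 1 * expR (- (a ^+ 2 + b ^+ 2) / 2).
have m0 : 0 < m by rewrite mulr_gt0 ?expR_gt0// normal_peak_gt0 ?oner_neq0.
apply: (@lt_le_trans _ _ (m * (b - a))%:E).
  by rewrite lte_fin mulr_gt0// subr_gt0.
rewrite integral_indic// setIT.
rewrite [leRHS](gamE (measurable_itv _)) /normal_prob.
apply: (@le_trans _ _ (\int[lebesgue_measure]_(x in `[a, b]) m%:E)%E).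
  rewrite integral_cst// [X in (_ * X)%E](_ : _ = (b - a)%:E) -?EFinM//.
  rewrite [LHS](_ : _ = lebesgue_measure (`[a, b] : set (measurableTypeR R)))//.
  by rewrite lebesgue_measure_itv/= lte_fin ab.
apply: ge0_le_integral => //.
- by move=> x _; rewrite lee_fin ltW.
- apply/measurable_EFinP/measurable_funTS; exact: measurable_normal_pdf.
move=> x /=; rewrite in_itv/= => /andP[ax xb].
rewrite lee_fin -/pdf pdfE ler_wpM2l ?normal_peak_ge0// ler_expR.
have : x ^+ 2 <= a ^+ 2 + b ^+ 2 by have [x0|x0] := leP 0 x; nra.
lra.
Qed.

Let far r : set R := [set x | r < `|x|].

Let mfar r : measurable (far r).
Proof.
by rewrite -[far r]setTI; apply: measurable_fun_ltr.
Qed.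

Let efar r : exp_bounded \1_(far r).
Proof. exact: exp_bounded_indic. Qed.

Let far2_gt0 : 0 < E \1_(far 2).
Proof.
have : (3 : R) < 4 by lra.
move=> /gauss_itv_gt0 /lt_le_trans; apply.
apply: gauss_expectation_le; [exact: exp_bounded_indic..|move=> x].
rewrite !indicE; have [|_] := boolP (x \in `[3, 4]%classic); last first.
  by case: (_ \in _).
rewrite inE /= in_itv/= => /andP[x3 x4].
rewrite mem_set//= /far/= (lt_le_trans _ (ler_norm _))//; lra.
Qed.

Let far1_lt1 : E \1_(far 1) < 1.
Proof.
have : (- 1 : R) < 1 by lra.
move=> /gauss_itv_gt0 h.
suff : E \1_(far 1) + E \1_`[(- 1 : R), 1] <= 1 by lra.
rewrite -gauss_expectationD; [|exact: exp_bounded_indic..].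
rewrite -[leRHS]gauss_expectation_cst; apply: gauss_expectation_le.
- by apply: exp_boundedD; exact: exp_bounded_indic.
- exact: exp_bounded_cst.
move=> x; rewrite !indicE.
have [|_] := boolP (x \in `[- 1, 1]%classic); last by case: (_ \in _); rewrite /=; lra.
rewrite inE /= in_itv/= -ler_norml => x1.
by rewrite memNset/= ?add0r//= /far /=; apply/negP; rewrite -leNgt.
Qed.

(** By symmetry [|t + x| ^ p] may be averaged with [|t - x| ^ p]. Convexity of the power
    [q = p / 2 >= 1], applied to the squares of [t + x] and [t - x], bounds the average below by
    [(t^2 + x^2) ^ q]. *)
Lemma gauss_moment_shift_lb p : 2 <= p -> exists c, 0 < c /\
  forall t, mu p + c * t ^+ 2 <= A p t /\ mu p + `|t| `^ p <= A p t.
Proof.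
move=> p2; exists (E \1_(far 2)); split => // t.
have p0 : 0 <= p by lra.
have ea := eb_abs p0.
pose q := p / 2; have q1 : 1 <= q by rewrite /q; lra.
have et : exp_bounded (fun x => `|t + x| `^ p) by exact: exp_bounded_powR.
have etN : exp_bounded (fun x => `|t + - x| `^ p).
  apply: (@exp_bounded_opp _ (fun x => `|t + x| `^ p)) => //.
have powE (y : R) : `|y| `^ p = (y ^+ 2) `^ q.
  by rewrite -real_normK ?num_real// -powR_mulrn// -powRrM /q mulrCA mulfV ?mulr1.
have AE : A p t = E (fun x => 2^-1 * `|t + x| `^ p + 2^-1 * `|t + - x| `^ p).
  rewrite gauss_expectationD; last 2 first.
  - by apply: exp_boundedM => //; exact: exp_bounded_cst.
  - by apply: exp_boundedM => //; exact: exp_bounded_cst.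
  by rewrite !gauss_expectationZ// (gauss_expectation_opp et) /A; lra.
have mid x : (t ^+ 2 + x ^+ 2) `^ q <=
    2^-1 * `|t + x| `^ p + 2^-1 * `|t + - x| `^ p.
  rewrite !powE; have -> : t ^+ 2 + x ^+ 2 =
      2^-1 * (t + x) ^+ 2 + (1 - 2^-1) * (t + - x) ^+ 2 by field.
  rewrite [X in _ + X * _ `^ _](_ : 2^-1 = 1 - 2^-1); last by lra.
  by apply: (convex_powR q1 (Itv01 _ _)) => //=;
    rewrite ?inE/= ?in_itv/= ?sqr_ge0//; lra.
have emid : exp_bounded
    (fun x => 2^-1 * `|t + x| `^ p + 2^-1 * `|t + - x| `^ p).
  by apply: exp_boundedD; apply: exp_boundedM => //; exact: exp_bounded_cst.
have q0 : 0 < q by lra.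
have q10 : 0 <= q - 1 by lra.
(* In [a (a + b) ^ (q - 1) + b (a + b) ^ (q - 1)] the [x^2] term is at least [|x| ^ p]. The [t^2]
   term is at least [t^2] when [|x| > 2], which explains the constant [c], and at least [|t| ^ p]
   always. *)
have split_pow (a b : R) : 0 <= a -> 0 <= b ->
    (a + b) `^ q = a * (a + b) `^ (q - 1) + b * (a + b) `^ (q - 1).
  by move=> a0 b0; rewrite -mulrDl mulr_powRB1// addr_ge0.
have t0 := sqr_ge0 t.
split.
- rewrite AE mulrC -gauss_expectationZ// -gauss_expectationD//; last first.
    by apply: exp_boundedM => //; exact: exp_bounded_cst.
  apply: gauss_expectation_le => //.
    by apply: exp_boundedD => //; apply: exp_boundedM => //; exact: exp_bounded_cst.
  move=> x; apply: le_trans (mid x); have x0 := sqr_ge0 x.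
  rewrite split_pow// addrC powE lerD//.
    rewrite ler_wpM2l// indicE.
    have [/set_mem xf|_] := boolP (x \in far 2); last exact: powR_ge0.
    apply: powR_ge1 => //.
    have x2 : 2 < `|x| by [].
    have : `|x| ^+ 2 = x ^+ 2 by rewrite real_normK ?num_real.
    nra.
  rewrite -(mulr_powRB1 x0 q0) ler_wpM2l//.
  by apply: ge0_ler_powR; rewrite ?nnegrE//; lra.
- rewrite AE -(gauss_expectation_cst (`|t| `^ p)).
  rewrite -gauss_expectationD//; last exact: exp_bounded_cst.
  apply: gauss_expectation_le => //.
    by apply: exp_boundedD => //; exact: exp_bounded_cst.
  move=> x; apply: le_trans (mid x); have x0 := sqr_ge0 x.
  rewrite split_pow// addrC !powE lerD// -(mulr_powRB1 _ q0)//.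
    by rewrite ler_wpM2l//; apply: ge0_ler_powR; rewrite ?nnegrE//; lra.
  by rewrite ler_wpM2l//; apply: ge0_ler_powR; rewrite ?nnegrE//; lra.
Qed.

(* The witness is the centred indicator [P(|eps| > 1) - 1_{|x| > 1}], whose
   covariance with [|x|^p] is negative. *)
Lemma gauss_tilt_direction p : 0 < p -> exists psi : R -> R,
  [/\ measurable_fun setT psi, (forall x, `|psi x| <= 1), E psi = 0 &
   exists c C, [/\ 0 < c, 0 <= C & forall t,
     E (fun x => psi x * `|t + x| `^ p) <= - c + C * local_power p t]].
Proof.
move=> p0.
pose ind : R -> R := \1_(far 1); pose q := E ind.
have ind01 x : 0 <= ind x <= 1.
  by rewrite /ind indicE; case: (_ \in _); rewrite ?lexx ?ler01.
have eind : exp_bounded ind by exact: efar.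
have q0 : 0 <= q by apply: gauss_expectation_ge0 => x; case/andP: (ind01 x).
have q1 : q < 1 by exact: far1_lt1.
pose psi x := q - ind x.
have eZ c g : exp_bounded g -> exp_bounded (fun x => c * g x).
  by move=> eg; apply: exp_boundedM => //; exact: exp_bounded_cst.
have epsi : exp_bounded psi.
  apply: exp_boundedD; first exact: exp_bounded_cst.
  by under eq_fun do rewrite -mulN1r; exact: eZ.
have psiM g : exp_bounded g ->
    E (fun x => psi x * g x) = q * E g - E (fun x => ind x * g x).
  move=> eg; have eig : exp_bounded (fun x => ind x * g x).
    exact: exp_boundedM.
  rewrite -gauss_expectationZ// -mulN1r -gauss_expectationZ//.
  rewrite -gauss_expectationD; [|exact: eZ..].
  by apply: eq_Rintegral => x _; rewrite /psi; ring.
have ea := eb_abs (ltW p0).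
have mu0 : 0 <= mu p by apply: gauss_expectation_ge0 => x; exact: powR_ge0.
pose nu := E (fun x => ind x * `|x| `^ p).
pose D := nu - q * mu p.
have pow2 : 1 < 2 `^ p :> R.
  by rewrite -[ltLHS](one_powR p) gt0_ltr_powR ?nnegrE//; lra.
(* As [psi] has mean 0, [|x| ^ p] may be replaced by [|x| ^ p - 1], which changes sign at [|x| = 1]
   as [psi] does. Hence [- psi x * (|x| ^ p - 1)] is nonnegative, and it is at least
   [(1 - q) (2 ^ p - 1)] for [|x| > 2]. *)
have D0 : 0 < D.
  have c0 : 0 < (1 - q) * (2 `^ p - 1) * E \1_(far 2).
    by rewrite !mulr_gt0// subr_gt0.
  apply: (lt_le_trans c0).
  have em1 : exp_bounded (fun x : R => `|x| `^ p - 1).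
    by apply: exp_boundedD => //; exact: exp_bounded_cst.
  have -> : D = E (fun x => - 1 * (psi x * (`|x| `^ p - 1))).
    rewrite gauss_expectationZ; last exact: exp_boundedM.
    rewrite psiM// gauss_expectationD//; last exact: exp_bounded_cst.
    have -> : E (fun x => ind x * (`|x| `^ p - 1)) = nu - q.
      transitivity (E (fun x => ind x * `|x| `^ p + -1 * ind x)).
        by apply: eq_Rintegral => x _; ring.
      rewrite gauss_expectationD; [|exact: exp_boundedM|exact: eZ].
      by rewrite gauss_expectationZ// mulN1r.
    by rewrite gauss_expectation_cst /D -/(mu p); ring.
  rewrite -gauss_expectationZ; last exact: efar.
  apply: gauss_expectation_le.
  - exact/eZ/efar.
  - exact/eZ/exp_boundedM.
  move=> x; rewrite /psi /ind !indicE.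
  have [/set_mem x1|] := boolP (x \in far 1); last first.
    move=> /negP; rewrite inE /far/= => /negP; rewrite -leNgt => x1.
    rewrite memNset /far/=; last by apply/negP; rewrite -leNgt; lra.
    have : `|x| `^ p <= 1.
      exact: powR_le1 (ltW p0) (normr_ge0 _) x1.
    by have := powR_ge0 `|x| p; nra.
  have xp1 : 1 <= `|x| `^ p by exact: powR_ge1 (ltW p0) (ltW x1).
  have [/set_mem x2|_] := boolP (x \in far 2); last by rewrite /=; nra.
  have : 2 `^ p <= `|x| `^ p by rewrite ge0_ler_powR ?nnegrE// ltW.
  by rewrite /=; nra.
have nu0 : 0 < nu by rewrite /D in D0; nra.
(* For [|x| > 1] one has [|t + x| >= (1 - |t|) |x|]. The radius [t0] is such that
   [rho ^ p * nu = nu - D / 2]: a shift with [|t| <= t0] loses at most half of the gap [D]. *)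
pose rho := (1 - D / (2 * nu)) `^ p^-1; pose t0 := 1 - rho.
have DnuE : D / (2 * nu) * nu = D / 2 by field; rewrite gt_eqF.
have Dnu0 : 0 < D / (2 * nu) by rewrite divr_gt0// mulr_gt0.
have Dnu1 : D / (2 * nu) < 1.
  by rewrite ltr_pdivrMr ?mulr_gt0// /D; nra.
have rhoE : rho `^ p = 1 - D / (2 * nu).
  by rewrite /rho -powRrM mulVf ?gt_eqF// powRr1// subr_ge0 ltW.
have rho0 : 0 < rho by rewrite powR_gt0// subr_gt0.
have rho1 : rho < 1.
  rewrite -[ltRHS](one_powR p^-1) gt0_ltr_powR ?invr_gt0 ?nnegrE ?subr_ge0//.
    exact: ltW.
  by rewrite ltrBlDr ltrDl.
have t00 : 0 < t0 by rewrite subr_gt0.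
have [Cu [Cu0 AC]] := gauss_moment_shift_ub p0.
exists psi; split.
- by case: epsi.
- move=> x; have := ind01 x; rewrite ler_norml /psi; lra.
- have := psiM (fun=> 1) (exp_bounded_cst 1).
  rewrite gauss_expectation_cst mulr1.
  under eq_Rintegral do rewrite mulr1.
  under [in RHS]eq_Rintegral do rewrite mulr1.
  by rewrite subrr.
(* The term [Cu] pays for the growth of [A p t]. For [|t| > t0], where [local_power p t >= t0 ^+ 2],
   the second term also absorbs [mu p + D / 2]. *)
exists (D / 2), (Cu + (mu p + D / 2) / t0 ^+ 2); split.
- by rewrite divr_gt0.
- by rewrite addr_ge0// divr_ge0 ?sqr_ge0// addr_ge0// divr_ge0// ltW.
move=> t; have et : exp_bounded (fun x => `|t + x| `^ p).
  exact/exp_bounded_powR/ltW.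
have w0 : 0 <= local_power p t.
  by rewrite /local_power; case: ifP; rewrite ?sqr_ge0 ?powR_ge0.
have r0 : 0 <= (mu p + D / 2) / t0 ^+ 2.
  by rewrite divr_ge0 ?sqr_ge0// addr_ge0// divr_ge0// ltW.
have A0 : 0 <= A p t by apply: gauss_expectation_ge0 => x; exact: powR_ge0.
have At := AC t.
rewrite psiM// -/(A p t).
have [tt0|tt0] := leP `|t| t0.
  have t1 : `|t| <= 1 by rewrite (le_trans tt0)// /t0; lra.
  have : (1 - `|t|) `^ p * nu <= E (fun x => ind x * `|t + x| `^ p).
    rewrite -gauss_expectationZ; last exact: exp_boundedM.
    apply: gauss_expectation_le.
    - exact/eZ/exp_boundedM.
    - exact: exp_boundedM.
    move=> x; rewrite /ind indicE.
    have [/set_mem x1|_] := boolP (x \in far 1); last by rewrite !mul0r mulr0.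
    have {}x1 : 1 < `|x| by [].
    rewrite !mul1r -powRM ?subr_ge0// ge0_ler_powR ?nnegrE ?mulr_ge0 ?subr_ge0//.
      exact: ltW.
    have : `|x| <= `|t + x| + `|t|.
      by have := ler_normB (t + x) t; rewrite addrAC subrr add0r.
    have := normr_ge0 t; nra.
  have : rho `^ p <= (1 - `|t|) `^ p.
    apply: ge0_ler_powR; rewrite ?nnegrE ?subr_ge0 ?(ltW p0) ?(ltW rho0)//.
    by move: tt0; rewrite /t0; lra.
  rewrite rhoE => h1 h2.
  have h3 : nu - D / 2 <= (1 - `|t|) `^ p * nu.
    by rewrite -DnuE; nra.
  have h4 : q * A p t <= q * mu p + Cu * local_power p t.
    have : 0 <= Cu * local_power p t by exact: mulr_ge0.
    nra.
  have h5 : 0 <= (mu p + D / 2) / t0 ^+ 2 * local_power p t by exact: mulr_ge0.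
  rewrite [leRHS](_ : _ = - (D / 2) + Cu * local_power p t +
      (mu p + D / 2) / t0 ^+ 2 * local_power p t); last by ring.
  have DE : D = nu - q * mu p by [].
  lra.
have w1 : t0 ^+ 2 <= local_power p t.
  rewrite /local_power; case: ifPn => [t1|].
    have : `|t| ^+ 2 = t ^+ 2 by rewrite real_normK ?num_real.
    nra.
  rewrite -ltNge => t1; apply: (@le_trans _ _ 1); first by rewrite /t0; nra.
  exact: powR_ge1 (ltW p0) (ltW t1).
have h1 : mu p + D / 2 <= (mu p + D / 2) / t0 ^+ 2 * local_power p t.
  rewrite mulrAC ler_pdivlMr ?exprn_gt0// ler_wpM2l// addr_ge0//.
  by rewrite divr_ge0// ltW.
have h2 : 0 <= E (fun x => ind x * `|t + x| `^ p).
  by apply: gauss_expectation_ge0 => x; rewrite mulr_ge0 ?powR_ge0.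
have h3 : q * A p t <= A p t by rewrite ler_piMl// ltW.
rewrite [leRHS](_ : _ = - (D / 2) + Cu * local_power p t +
  (mu p + D / 2) / t0 ^+ 2 * local_power p t); last by ring.
lra.
Qed.

End standard_gaussian.

(** * Critical values and power of tests based on sums of p-th powers *)

Section power_sum_tests.
Context (R : realType) (disp : measure_display) (T : measurableType disp)
  (P : probability T R) (eps : nat -> {RV P >-> R}).
Context (gam : probability R R).
Hypothesis gamE : forall A, measurable A -> gam A = normal_prob 0 1 A.
Hypothesis law : forall i A, measurable A -> P (eps i @^-1` A) = gam A.
Hypothesis indep : mutually_independent eps.
Context (p : R).
Hypothesis p0 : 0 < p.

Local Notation E := (Rintegral gam setT).
(* Kept abstract so that conversion never unfolds the integral. *)
Context (A : R -> R -> R).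
Hypothesis AE : forall q t, A q t = E (fun x => `|t + x| `^ q).
Local Notation mu := (A p 0).

Let muE : mu = E (fun x => `|x| `^ p).
Proof. by rewrite AE; apply: eq_Rintegral => x _; rewrite add0r. Qed.

Let A_ge0 q t : 0 <= A q t.
Proof. by rewrite AE; apply: gauss_expectation_ge0 => x; exact: powR_ge0. Qed.

Let lp_ge0 t : 0 <= local_power p t.
Proof. by rewrite /local_power; case: ifP; rewrite ?sqr_ge0 ?powR_ge0. Qed.

Definition power_sum (th : nat -> R) d w := \sum_(i < d) `|th i + eps i w| `^ p.
Let S := power_sum.

Let Y (th : nat -> R) i x := `|th i + x| `^ p.

Let eY th i : exp_bounded (Y th i).
Proof. exact/exp_bounded_powR/ltW. Qed.

Let mY th i : measurable_fun setT (Y th i).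
Proof. by case: (eY th i). Qed.

Let Y0 th i x : 0 <= Y th i x. Proof. exact: powR_ge0. Qed.

Let Y2 th i x : Y th i x ^+ 2 = `|th i + x| `^ (p * 2).
Proof. by rewrite /Y -powR_mulrn ?powR_ge0// -powRrM. Qed.

Lemma measurable_power_sum th d : measurable_fun setT (S th d).
Proof.
apply: measurable_sum => i; apply: (measurableT_comp (mY th i)) => //.
Qed.

Lemma measurable_accept th d K : measurable [set w | S th d w < K].
Proof.
rewrite -[[set _ | _]]setTI; apply: measurable_fun_ltr => //.
exact: measurable_power_sum.
Qed.

Lemma measurable_reject th d K : measurable [set w | K <= S th d w].
Proof.
rewrite -[[set _ | _]]setTI; apply: measurable_fun_ler => //.
exact: measurable_power_sum.
Qed.

Definition acceptance th d K := fine (P [set w | S th d w < K]).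
Definition rejection th d K := fine (P [set w | K <= S th d w]).

Lemma rejectionE th d K : rejection th d K = 1 - acceptance th d K.
Proof.
have mA := measurable_accept th d K.
rewrite /rejection /acceptance.
have -> : [set w | K <= S th d w] = ~` [set w | S th d w < K].
  by apply/seteqP; split => w /=; rewrite leNgt => /negP.
by rewrite probability_setC// fineB ?fin_num_measure.
Qed.

(** The weighted inequality with weight 1; the variance of [|t + eps| ^ p] is
    [A (p * 2) t - A p t ^+ 2]. *)
Lemma power_sum_chebyshev th d (B : set T) (a : R) : measurable B -> 0 < a ->
  (forall w, B w -> a <= (S th d w - \sum_(i < d) A p (th i)) ^+ 2) ->
  fine (P B) <= (\sum_(i < d) (A (p * 2) (th i) - A p (th i) ^+ 2)) / a.
Proof.
move=> mB a0 Ba.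
have H : (a%:E * \int[P]_w (product_weight eps (fun=> 1) d w * \1_B w)%:E <=
    (\sum_(i < d) (A (p * 2) (th i) - A p (th i) ^+ 2))%:E)%E.
  apply: (@weighted_chebyshev _ _ _ _ _ gam indep law (fun=> 1) (Y th)
    (fun i => A p (th i)) (fun i => A (p * 2) (th i))) => //.
  - by rewrite integral_cst// mul1e; exact: probability_setT.
  - move=> i; under eq_integral do rewrite mul1r.
    by rewrite AE; exact: (gauss_EFin gamE).
  - move=> i; under eq_integral do rewrite mul1r Y2.
    rewrite AE.
    by apply: (gauss_EFin gamE); apply: exp_bounded_powR; rewrite mulr_ge0// ltW.
have W1 w : product_weight eps (fun=> 1) d w = 1.
  by rewrite /product_weight big1.
move: H; under eq_integral do rewrite W1 mul1r.
rewrite integral_indic// setIT => H.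
by rewrite ler_pdivlMr// mulrC -lee_fin EFinM fineK ?fin_num_measure.
Qed.

Let sqrtd_gt0 d : (0 < d)%N -> 0 < Num.sqrt d%:R :> R.
Proof. by move=> d0; rewrite sqrtr_gt0 ltr0n. Qed.

Let sqr_sqrtd d : Num.sqrt d%:R ^+ 2 = d%:R :> R.
Proof. by rewrite sqr_sqrtr. Qed.

(** A threshold further than [C * sqrt d] from the null mean would, by Chebyshev, force the null
    probability of acceptance or of rejection below [m / 2]. The rejection probability is eventually
    closer than [m / 2] to [alpha], which rules this out. *)
Lemma critical_value_bounds (K : nat -> R) (alpha : R) : 0 < alpha < 1 ->
  rejection (fun=> 0) d (K d) @[d --> \oo] --> alpha ->
  exists C, 0 < C /\ \forall d \near \oo,
    d%:R * mu - C * Num.sqrt d%:R <= K d <= d%:R * mu + C * Num.sqrt d%:R.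
Proof.
move=> /andP[al0 al1] Kal.
pose v := A (p * 2) 0; have v0 : 0 <= v by exact: A_ge0.
pose m := Num.min alpha (1 - alpha).
have m0 : 0 < m by rewrite lt_min al0 subr_gt0.
have ma : m <= alpha by rewrite ge_min lexx.
have m1a : m <= 1 - alpha by rewrite ge_min lexx orbT.
(* Chosen so that [C ^+ 2 >= C >= 2 * v / m], whence [v / C ^+ 2 <= m / 2]. *)
pose C := 1 + 2 * v / m; exists C.
have C1 : 1 <= C by rewrite lerDl divr_ge0 ?mulr_ge0// ltW.
have C0 : 0 < C by lra.
split=> //; near=> d.
have d0 : (0 < d)%N by near: d; exact: nbhs_infty_gt.
have dR0 : 0 < d%:R :> R by rewrite ltr0n.
have s0 := sqrtd_gt0 d0.
have : `|alpha - rejection (fun=> 0) d (K d)| < m / 2.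
  by near: d; move/cvgrPdist_lt: Kal; apply; rewrite divr_gt0.
rewrite ltr_norml => /andP[r1 r2].
have cheb B : measurable B -> (forall w, B w ->
    (C * Num.sqrt d%:R) ^+ 2 <= (S (fun=> 0) d w - d%:R * mu) ^+ 2) ->
    fine (P B) <= m / 2.
  move=> mB Bw.
  have := @power_sum_chebyshev (fun=> 0) d B ((C * Num.sqrt d%:R) ^+ 2) mB.
  rewrite sumr_const card_ord -[mu *+ d]mulr_natl => /(_ _ Bw) H.
  apply: (le_trans (H _)); first by rewrite exprn_gt0// mulr_gt0.
  rewrite sumr_const card_ord -[X in X / _]mulr_natl exprMn sqr_sqrtd.
  rewrite ler_pdivrMr ?mulr_gt0 ?exprn_gt0// mulrC mulrA.
  rewrite ler_wpM2r ?ler0n//.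
  apply: (@le_trans _ _ v); first by rewrite gerBl sqr_ge0.
  apply: (@le_trans _ _ (m / 2 * C)).
    rewrite /C mulrDr; have -> : m / 2 * (2 * v / m) = v by field; rewrite gt_eqF.
    by rewrite lerDr; lra.
  by rewrite ler_wpM2l ?expr2 ?ler_peMr//; lra.
have acc := rejectionE (fun=> 0) d (K d).
apply/andP; split; rewrite leNgt; apply/negP => Kd.
- have : acceptance (fun=> 0) d (K d) <= m / 2.
    apply: cheb; first exact: measurable_accept.
    move=> w /= wK; rewrite -(sqrrN (S _ _ _ - _)) lerXn2r ?nnegrE//.
    + by rewrite mulr_ge0// ltW.
    + by have : 0 < C * Num.sqrt d%:R by [exact: mulr_gt0]; lra.
    + by lra.
  lra.
- have : rejection (fun=> 0) d (K d) <= m / 2.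
    apply: cheb; first exact: measurable_reject.
    move=> w /= wK; rewrite lerXn2r ?nnegrE//.
    + by rewrite mulr_ge0// ltW.
    + by have : 0 < C * Num.sqrt d%:R by [exact: mulr_gt0]; lra.
    + by lra.
  lra.
Unshelve. all: by end_near. Qed.

(** The gap [G] between the mean and the null mean outgrows [sqrt d], so acceptance requires a
    deviation of at least [G / 2]. The variance is at most a small multiple of [G ^+ 2]. *)
Lemma acceptance_to0 (K : nat -> R) (C : R) (th : nat -> nat -> R) : 2 <= p ->
  0 < C ->
  (\forall d \near \oo, K d <= d%:R * mu + C * Num.sqrt d%:R) ->
  (forall B : R, \forall d \near \oo, B * Num.sqrt d%:R <=
    Num.max (\sum_(i < d) th d i ^+ 2) (\sum_(i < d) `|th d i| `^ p)) ->
  forall e : R, 0 < e -> \forall d \near \oo, acceptance (th d) d (K d) <= e.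
Proof.
move=> p2 C0 KC thy e e0.
have [c [c0 Alb]] : exists c, 0 < c /\ forall t,
    mu + c * t ^+ 2 <= A p t /\ mu + `|t| `^ p <= A p t.
  have [c [c0 H]] := gauss_moment_shift_lb gamE p2.
  by exists c; split => // t; rewrite muE AE.
have [D [D0 Aub]] : exists D, 0 <= D /\ forall t,
    A (p * 2) t <= (1 + e / 8) * `|t| `^ (p * 2) + D.
  have [||D [D0 H]] := @gauss_moment_shift_le _ _ gamE (p * 2) (e / 8).
  - by rewrite mulr_gt0.
  - by rewrite divr_gt0.
  by exists D; split => // t; rewrite AE.
pose c' := Num.min c 1; have c'0 : 0 < c' by rewrite lt_min c0 ltr01.
(* The part [2 * C] makes [C * sqrt d <= G / 2]; the rest gives [B ^+ 2 >= 8 * D / e], so that the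
   variance term [d * D] is at most [e / 8 * G ^+ 2]. *)
pose B := 2 * C + (1 + 8 * D / e).
have De0 : 0 <= 8 * D / e by rewrite divr_ge0 ?mulr_ge0// ltW.
have B0 : 0 < B by rewrite /B; lra.
near=> d.
have d0 : (0 < d)%N by near: d; exact: nbhs_infty_gt.
have dR0 : 0 < d%:R :> R by rewrite ltr0n.
have Kd : K d <= d%:R * mu + C * Num.sqrt d%:R by near: d; exact: KC.
have : B / c' * Num.sqrt d%:R <= Num.max (\sum_(i < d) th d i ^+ 2)
    (\sum_(i < d) `|th d i| `^ p) by near: d; exact: thy.
have s0 := sqrtd_gt0 d0; set s := Num.sqrt d%:R in s0 Kd *.
set t2 := \sum_(i < d) th d i ^+ 2; set tp := \sum_(i < d) `|_| `^ p => Bmax.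
pose G := \sum_(i < d) A p (th d i) - d%:R * mu.
have GE : G = \sum_(i < d) (A p (th d i) - mu).
  by rewrite /G sumrB sumr_const card_ord mulr_natl.
have Gtp : tp <= G.
  by rewrite GE; apply: ler_sum => i _; have [_ h] := Alb (th d i); lra.
have Gt2 : c * t2 <= G.
  rewrite GE mulr_sumr; apply: ler_sum => i _.
  have [h _] := Alb (th d i); lra.
have tp0 : 0 <= tp by apply: sumr_ge0 => i _; exact: powR_ge0.
have t20 : 0 <= t2 by apply: sumr_ge0 => i _; exact: sqr_ge0.
have GB : B * s <= G.
  have : c' * (B / c' * s) <= c' * Num.max t2 tp by rewrite ler_wpM2l// ltW.
  have -> : c' * (B / c' * s) = B * s by field; rewrite gt_eqF.
  move=> /le_trans; apply; have [_|_] := leP t2 tp.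
    by apply: le_trans Gtp; rewrite ler_piMl// ge_min lexx orbT.
  by apply: le_trans Gt2; rewrite ler_wpM2r// ge_min lexx.
have G0 : 0 < G by rewrite (lt_le_trans _ GB)// mulr_gt0.
have G2 : 2 * C * s <= G.
  by apply: le_trans GB; rewrite ler_wpM2r ?(ltW s0)// /B; lra.
have G20 : 0 < (G / 2) ^+ 2 by rewrite exprn_gt0// divr_gt0.
apply: (le_trans (@power_sum_chebyshev (th d) d _ _
  (measurable_accept _ _ _) G20 _)).
  move=> w wK; have {}wK : S (th d) d w < K d by [].
  have h : G / 2 <= \sum_(i < d) A p (th d i) - S (th d) d w.
    by rewrite /G in G2 *; lra.
  rewrite -(sqrrN (S _ _ _ - _)) opprB lerXn2r ?nnegrE ?divr_ge0 ?(ltW G0)//.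
  by apply: le_trans h; rewrite divr_ge0 ?(ltW G0).
rewrite ler_pdivrMr//.
(* Since [A p t ^+ 2 >= |t| ^ (2 p)], only [e / 8] times the leading term survives, and the sum of
   squares is at most [tp ^+ 2 <= G ^+ 2]. *)
have : \sum_(i < d) (A (p * 2) (th d i) - A p (th d i) ^+ 2) <=
    e / 8 * tp ^+ 2 + d%:R * D.
  apply: (@le_trans _ _ (\sum_(i < d) (e / 8 * (`|th d i| `^ p) ^+ 2 + D))).
    apply: ler_sum => i _; have h1 := Aub (th d i).
    have [_ h2] := Alb (th d i); have h3 := powR_ge0 `|th d i| p.
    move: h1; rewrite powRrM powR_mulrn ?powR_ge0// => h1.
    have h4 : (`|th d i| `^ p) ^+ 2 <= A p (th d i) ^+ 2.
      rewrite lerXn2r ?nnegrE//; have := A_ge0 p 0; lra.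
    lra.
  rewrite big_split/= sumr_const card_ord mulr_natl lerD2r -mulr_sumr.
  rewrite ler_wpM2l//; first by rewrite divr_ge0// ltW.
  rewrite expr2 mulr_suml; apply: ler_sum => i _; rewrite expr2 ler_wpM2l ?powR_ge0//.
  by rewrite /tp (bigD1 i)//= lerDl sumr_ge0// => j _; exact: powR_ge0.
move=> /le_trans; apply.
have tpG : tp ^+ 2 <= G ^+ 2 by rewrite lerXn2r ?nnegrE// ltW.
have dDG : d%:R * D * 8 <= e * G ^+ 2.
  have : (B * s) ^+ 2 <= G ^+ 2.
    by rewrite lerXn2r ?nnegrE ?mulr_ge0 ?(ltW G0) ?(ltW B0) ?(ltW s0).
  rewrite exprMn /s sqr_sqrtd => BG.
  apply: (@le_trans _ _ (e * (B ^+ 2 * d%:R))); last by rewrite ler_wpM2l// ltW.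
  rewrite [leLHS](_ : _ = e * ((8 * D / e) * d%:R)); last by field; rewrite gt_eqF.
  rewrite ler_wpM2l ?(ltW e0)// ler_wpM2r ?(ltW dR0)//.
  have : 8 * D / e <= B by rewrite /B; lra.
  have : 1 <= B by rewrite /B; lra.
  nra.
have : e / 8 * tp ^+ 2 <= e / 8 * G ^+ 2 by rewrite ler_wpM2l// divr_ge0// ltW.
rewrite exprMn; lra.
Unshelve. all: by end_near. Qed.

(* The tilted density [1 + c / sqrt d * psi] lowers the mean of the power sum
   by a multiple of [sqrt d], while the product density over the [d]
   coordinates keeps its second moment below [expR (c ^+ 2)]. *)
Lemma acceptance_lower_bound (K : nat -> R) (C M : R) : 0 < C -> 0 < M ->
  (\forall d \near \oo, d%:R * mu - C * Num.sqrt d%:R <= K d) ->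
  exists2 delta : R, 0 < delta &
    \forall d \near \oo, forall th : nat -> R,
    \sum_(i < d) local_power p (th i) <= M * Num.sqrt d%:R ->
    delta <= acceptance th d (K d).
Proof.
move=> C0 M0 KC.
have [Cu [Cu0 Aub]] : exists C, 0 <= C /\ forall t,
    A p t <= mu + C * local_power p t.
  have [Cu [Cu0 H]] := gauss_moment_shift_ub gamE p0.
  by exists Cu; split => // t; rewrite muE AE.
have [psi [mpsi psi1 Epsi [c0 [Ct [c00 Ct0 tilt]]]]] :=
  gauss_tilt_direction gamE p0.
have [D [D0 A2]] : exists D, 0 <= D /\ forall t,
    A (p * 2) t <= (1 + 1) * `|t| `^ (p * 2) + D.
  have [||D [D0 H]] := @gauss_moment_shift_le _ _ gamE (p * 2) 1 => //.
  - by rewrite mulr_gt0.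
  by exists D; split => // t; rewrite AE.
(* The tilted variance will be at most [V * d], and [a0] satisfies [V / a0 ^+ 2 <= 1 / 2]. The tilt
   strength [c] is such that the drop [c0 * c * sqrt d] of the mean covers the effect of the shift,
   the slack [C] of the threshold and a margin [a0]. *)
pose V := 2 * (2 + D + 2 * M ^+ 2).
pose a0 := 1 + 2 * V.
have V0 : 0 < V by rewrite /V mulr_gt0// -addrA ltr_wpDr// addr_ge0// mulr_ge0// sqr_ge0.
pose c := (a0 + (Cu + Ct) * M + C) / c0.
have CM0 : 0 <= (Cu + Ct) * M by rewrite mulr_ge0 ?addr_ge0// ltW.
have c_gt0 : 0 < c by rewrite divr_gt0// /a0; lra.
have cE : c0 * c = a0 + (Cu + Ct) * M + C.
  by rewrite /c mulrC divfK// gt_eqF.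
(* In [tilted_lower_bound], the Chebyshev term takes 1/2 of the mass and the quadratic bound on [W]
   takes 1/4. The remaining 1/4 is at most [expR (c ^+ 2)] times the acceptance probability. *)
exists (4 * expR (c ^+ 2))^-1; first by rewrite invr_gt0 mulr_gt0// expR_gt0.
near=> d => th thM.
have d0 : (0 < d)%N by near: d; exact: nbhs_infty_gt.
have dR0 : 0 < d%:R :> R by rewrite ltr0n.
have Kd : d%:R * mu - C * Num.sqrt d%:R <= K d by near: d; exact: KC.
(* This gives [r <= 1], hence [L >= 0] because [psi] is bounded by 1. *)
have c2d : c ^+ 2 <= d%:R by near: d; exact: nbhs_infty_ger.
have s0 := sqrtd_gt0 d0; set s := Num.sqrt d%:R in s0 thM Kd *.
have sE : s ^+ 2 = d%:R by exact: sqr_sqrtd.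
have cd : c <= s.
  move: c2d.
  by rewrite -sE ler_sqr ?nnegrE ?(ltW c_gt0) ?(ltW s0).
pose r := c / s.
have r0 : 0 <= r by rewrite divr_ge0// ltW.
have r1 : r <= 1 by rewrite ler_pdivrMr// mul1r.
have rs : r * s = c by rewrite /r divfK// gt_eqF.
pose L x := 1 + r * psi x.
have psiN1 x : - 1 <= psi x <= 1 by have := psi1 x; rewrite ler_norml.
have L0 x : 0 <= L x.
  by rewrite /L; have /andP[] := psiN1 x; nra.
have epsi : exp_bounded psi by exact: exp_bounded_bounded psi1.
have eZ b g : exp_bounded g -> exp_bounded (fun x => b * g x).
  by move=> eg; apply: exp_boundedM => //; exact: exp_bounded_cst.
have eL : exp_bounded L.
  by apply: exp_boundedD; [exact: exp_bounded_cst|exact: eZ].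
have EL g : exp_bounded g ->
    E (fun x => L x * g x) = E g + r * E (fun x => psi x * g x).
  move=> eg; have epg : exp_bounded (fun x => psi x * g x) by exact: exp_boundedM.
  rewrite -(gauss_expectationZ gamE)// -(gauss_expectationD gamE)//; last exact: eZ.
  by apply: eq_Rintegral => x _; rewrite /L; ring.
have EL1 : E L = 1.
  have := EL (fun=> 1) (exp_bounded_cst 1).
  under eq_Rintegral do rewrite mulr1.
  under [in X in _ + X]eq_Rintegral do rewrite mulr1.
  by rewrite Epsi mulr0 addr0 gauss_expectation_cst.
(* As [psi] is centred, the second moment is [1 + r ^+ 2 * E psi^2]. Since [r ^+ 2 * d = c ^+ 2],
   its [d]-th power is at most [expR (c ^+ 2)]. *)
have EL2 : E (fun x => L x ^+ 2) <= expR (r ^+ 2).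
  apply: (@le_trans _ _ (1 + r ^+ 2)); last exact: expR_ge1Dx.
  have -> : E (fun x => L x ^+ 2) = E L + r * E (fun x => psi x * L x).
    rewrite -(EL L eL); exact: eq_Rintegral.
  rewrite EL1 lerD2l expr2 ler_wpM2l//.
  have -> : E (fun x => psi x * L x) = r * E (fun x => psi x * psi x).
    have -> : E (fun x => psi x * L x) = E (fun x => L x * psi x).
      by apply: eq_Rintegral => x _; rewrite mulrC.
    by rewrite EL// Epsi add0r.
  rewrite ler_piMr// -[leRHS](gauss_expectation_cst gam).
  apply: (gauss_expectation_le gamE).
  - exact: exp_boundedM.
  - exact: exp_bounded_cst.
  - by move=> x; have /andP[] := psiN1 x; nra.
have EL20 : 0 <= E (fun x => L x ^+ 2).
  by apply: gauss_expectation_ge0 => x; exact: sqr_ge0.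
pose m i := E (fun x => L x * Y th i x).
pose v i := E (fun x => L x * Y th i x ^+ 2).
have eY2 i : exp_bounded (fun x => Y th i x ^+ 2).
  by apply: exp_boundedM; exact: eY.
have wsum0 : 0 <= \sum_(i < d) local_power p (th i).
  by apply: sumr_ge0.
have msum : \sum_(i < d) m i <= d%:R * mu - C * s - a0 * s.
  apply: (@le_trans _ _ (\sum_(i < d)
      (mu - r * c0 + (Cu + Ct) * local_power p (th i)))).
    apply: ler_sum => i _; rewrite /m EL// -AE.
    have h1 := Aub (th i); have h2 := tilt (th i).
    have h3 : r * E (fun x => psi x * Y th i x) <=
        r * (- c0 + Ct * local_power p (th i)) by rewrite ler_wpM2l.
    have h4 : r * (Ct * local_power p (th i)) <= Ct * local_power p (th i).
      by rewrite ler_piMl// mulr_ge0.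
    rewrite [leRHS](_ : _ = (mu + Cu * local_power p (th i)) +
      (- (r * c0) + Ct * local_power p (th i))); last by ring.
    by apply: lerD => //; apply: (le_trans h3); rewrite mulrDr mulrN lerD2l.
  rewrite big_split/= sumr_const card_ord -mulr_sumr -[(mu - _) *+ d]mulr_natl.
  have : (Cu + Ct) * \sum_(i < d) local_power p (th i) <= (Cu + Ct) * (M * s).
    by rewrite ler_wpM2l// addr_ge0.
  have -> : d%:R * (mu - r * c0) = d%:R * mu - c0 * c * s.
    by rewrite -rs -sE; ring.
  by rewrite cE; lra.
(* Here [L <= 2], and the sum of the squared [local_power] terms is at most the square of their sum,
   that is [M ^+ 2 * d]. *)
have vsum : \sum_(i < d) (v i - m i ^+ 2) <= V * d%:R.
  apply: (@le_trans _ _ (\sum_(i < d)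
      (2 * (2 + D) + 4 * local_power p (th i) ^+ 2))).
    apply: ler_sum => i _; apply: (@le_trans _ _ (v i)).
      by rewrite gerBl sqr_ge0.
    apply: (@le_trans _ _ (2 * A (p * 2) (th i))).
      rewrite /v AE -(gauss_expectationZ gamE); last first.
        by apply: exp_bounded_powR; rewrite mulr_ge0// ltW.
      apply: (gauss_expectation_le gamE).
      - exact: exp_boundedM.
      - by apply/eZ/exp_bounded_powR; rewrite mulr_ge0// ltW.
      - move=> x; rewrite Y2 ler_wpM2r ?powR_ge0// /L.
        by have /andP[] := psiN1 x; nra.
    have := A2 (th i).
    have : `|th i| `^ (p * 2) <= 1 + local_power p (th i) ^+ 2.
      rewrite powRrM powR_mulrn ?powR_ge0// /local_power; case: ifPn => t1.
        have : `|th i| `^ p <= 1.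
          exact: powR_le1 (ltW p0) (normr_ge0 _) t1.
        have := powR_ge0 `|th i| p; have := sqr_ge0 (th i ^+ 2); nra.
      by rewrite lerDr.
    lra.
  rewrite big_split/= sumr_const card_ord -mulr_sumr -[(2 * _) *+ d]mulr_natl.
  have : \sum_(i < d) local_power p (th i) ^+ 2 <= (M * s) ^+ 2.
    apply: (@le_trans _ _ ((\sum_(i < d) local_power p (th i)) ^+ 2)).
      rewrite [leRHS]expr2 mulr_suml; apply: ler_sum => i _.
      by rewrite expr2 ler_wpM2l// (bigD1 i)//= lerDl sumr_ge0.
    by rewrite lerXn2r ?nnegrE ?mulr_ge0 ?(ltW M0) ?(ltW s0).
  rewrite exprMn sE /V; lra.
have K0 : 0 < expR (c ^+ 2) by exact: expR_gt0.
have aa0 : 0 < (a0 * s) ^+ 2 by rewrite exprn_gt0// mulr_gt0// /a0; lra.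
have := @tilted_lower_bound _ _ _ _ _ gam indep law L (Y th) m v _ _ _ _ _ _ _ d
  [set w | S th d w < K d] ((a0 * s) ^+ 2) (E (fun x => L x ^+ 2)) (expR (c ^+ 2))
  (measurable_accept _ _ _).
rewrite -/(acceptance th d (K d)) => H.
have {}H : 1 <= (\sum_(i < d) (v i - m i ^+ 2)) / (a0 * s) ^+ 2 + 4^-1 +
    expR (c ^+ 2) * acceptance th d (K d).
  apply: H => //.
  - by case: eL.
  - by rewrite (gauss_EFin gamE)// EL1.
  - by move=> i; rewrite (gauss_EFin gamE)//; exact: exp_boundedM.
  - by move=> i; rewrite (gauss_EFin gamE)//; exact: exp_boundedM.
  - move=> w /= /negP; rewrite -leNgt => Kw.
    have as0 : 0 < a0 * s by rewrite mulr_gt0// /a0; lra.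
    by rewrite lerXn2r ?nnegrE//; move: msum Kd Kw; rewrite /S /power_sum; lra.
  - by rewrite (gauss_EFin gamE)//; exact: exp_boundedM.
  - apply: (@le_trans _ _ (expR (r ^+ 2) ^+ d)).
      by rewrite lerXn2r ?nnegrE// expR_ge0.
    by rewrite -expRM_natl ler_expR -sE -exprMn mulrC rs.
have h1 : (\sum_(i < d) (v i - m i ^+ 2)) / (a0 * s) ^+ 2 <= 2^-1.
  rewrite ler_pdivrMr// exprMn sE (le_trans vsum)// mulrA ler_wpM2r ?(ltW dR0)//.
  by rewrite /a0; nra.
rewrite invfM ler_pdivrMr// mulrC; lra.
Unshelve. all: by end_near. Qed.

End power_sum_tests.

(** * From row vectors and norms to sequences and power sums *)

Section triangular_arrays.
Context (R : realType).

(** Padding gives rows of all dimensions one type; with default 0 the zero row becomes the zero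
    sequence, the null hypothesis of [critical_value_bounds]. *)
Definition row_seq d (x : 'rV[R]_d) (i : nat) : R := oapp (x 0) 0 (insub i).

Lemma row_seqE d (x : 'rV[R]_d) (i : 'I_d) : row_seq x i = x 0 i.
Proof. by rewrite /row_seq valK. Qed.

Lemma pnorm_powR d (q : R) (x : 'rV[R]_d) : 0 < q ->
  pnorm q x `^ q = \sum_(i < d) `|row_seq x i| `^ q.
Proof.
move=> q0; rewrite /pnorm -powRrM mulVf ?gt_eqF// powRr1; last first.
  by apply: sumr_ge0 => i _; exact: powR_ge0.
by apply: eq_bigr => i _; rewrite row_seqE.
Qed.

Lemma pnorm2_sqr d (x : 'rV[R]_d) :
  pnorm 2 x `^ 2 = \sum_(i < d) row_seq x i ^+ 2.
Proof.
rewrite pnorm_powR//; apply: eq_bigr => i _.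
by rewrite powR_mulrn// real_normK ?num_real.
Qed.

(** Critical values may be negative. Truncation at 0 leaves the event unchanged and makes raising to
    the power [q] monotone. *)
Lemma le_pnorm d (q k : R) (x : 'rV[R]_d) : 0 < q ->
  (k <= pnorm q x) = (Num.max k 0 `^ q <= \sum_(i < d) `|row_seq x i| `^ q).
Proof.
move=> q0; rewrite -pnorm_powR//.
have n0 : 0 <= pnorm q x by exact: powR_ge0.
have m0 : 0 <= Num.max k 0 by rewrite le_max lexx orbT.
have -> : (k <= pnorm q x) = (Num.max k 0 <= pnorm q x).
  by rewrite ge_max n0 andbT.
apply/idP/idP => [kx|]; first by rewrite ge0_ler_powR ?nnegrE// ltW.
by rewrite !leNgt; apply: contra => xk; rewrite gt0_ltr_powR ?nnegrE.
Qed.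

Lemma powR_half_le d (B X : R) : (0 < d)%N ->
  (B <= d%:R `^ (- 2^-1) * X) = (B * Num.sqrt d%:R <= X).
Proof.
move=> d0; have s0 : 0 < Num.sqrt d%:R :> R by rewrite sqrtr_gt0 ltr0n.
by rewrite powRN powR12_sqrt ?ler0n// mulrC ler_pdivlMr.
Qed.

Lemma near_le_powR (a B : R) : 0 < a -> \forall d \near \oo, B <= d%:R `^ a.
Proof.
move=> a0; pose b := Num.max B 0; have b0 : 0 <= b by rewrite le_max lexx orbT.
near=> d; apply: (@le_trans _ _ b); first by rewrite le_max lexx.
have -> : b = (b `^ a^-1) `^ a by rewrite -powRrM mulVf ?gt_eqF// powRr1.
apply: ge0_ler_powR; rewrite ?nnegrE ?powR_ge0 ?ler0n ?(ltW a0)//.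
by near: d; exact: nbhs_infty_ger.
Unshelve. all: by end_near. Qed.

Lemma local_power_le_add (p t : R) : local_power p t <= t ^+ 2 + `|t| `^ p.
Proof.
by rewrite /local_power; case: ifP; rewrite ?lerDl ?lerDr ?powR_ge0 ?sqr_ge0.
Qed.

(** For [p < 2] the quadratic is the smaller of the two for [|t| <= 1] and the [p]-th power for
    [|t| > 1], so [local_power] is their minimum. *)
Lemma local_power_le_min (p t : R) : 0 < p < 2 ->
  local_power p t <= t ^+ 2 /\ local_power p t <= `|t| `^ p.
Proof.
move=> /andP[p0 p2]; rewrite /local_power.
have t2 : t ^+ 2 = `|t| `^ 2 by rewrite powR_mulrn// real_normK ?num_real.
case: ifPn => t1; rewrite t2; split => //.
  have [->|t0] := eqVneq t 0; first by rewrite normr0 powR0// powR_ge0.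
  by apply: ger_powR; rewrite ?normr_gt0 ?t0 ?t1// ltW.
by rewrite -ltNge in t1; apply: ler_powR; rewrite ltW.
Qed.

End triangular_arrays.

(** * Size and consistency of norm tests as statements on power sums *)

Section pnorm_test_power.
Context (R : realType) (disp : measure_display) (T : measurableType disp)
  (P : probability T R) (eps : nat -> {RV P >-> R}).
Hypothesis heps : iid_standard_normal eps.
Context (p : R).
Hypothesis p0 : 0 < p.

Lemma expectation_pnorm_test (kappa : nat -> R) d (x : 'rV[R]_d) :
  ('E_P[fun w => pnorm_test p kappa (x + noise eps d w)%R] =
   (rejection eps p (row_seq x) d (Num.max (kappa d) 0 `^ p))%:E)%E.
Proof.
set K := Num.max _ _ `^ p.
have mK := measurable_reject eps p0 (row_seq x) d K.
rewrite /rejection fineK ?fin_num_measure//.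
rewrite -expectation_indic//; congr (expectation P _); apply/funext => w.
rewrite /pnorm_test !indicE; congr (nat_of_bool _)%:R.
apply/idP/idP; rewrite !inE /= le_pnorm// /power_sum.
- by under eq_bigr do rewrite row_seqE !mxE -row_seqE.
- by under [X in _ -> _ <= X]eq_bigr do rewrite row_seqE !mxE -row_seqE.
Qed.

Lemma size_pnorm_test (alpha : R) (kappa : nat -> R) :
  tests_of_size eps alpha (pnorm_test p kappa) ->
  rejection eps p (fun=> 0) d (Num.max (kappa d) 0 `^ p)
    @[d --> \oo] --> alpha.
Proof.
move=> [_]; have E0 d : 'E_P[fun w => pnorm_test p kappa (noise eps d w)]%E =
    (rejection eps p (fun=> 0) d (Num.max (kappa d) 0 `^ p))%:E.
  have -> : (fun w => pnorm_test p kappa (noise eps d w)) =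
      (fun w => pnorm_test p kappa ((0 : 'rV[R]_d) + noise eps d w)).
    by apply/funext => w; rewrite [in RHS]add0r.
  rewrite expectation_pnorm_test.
  have -> : row_seq (0 : 'rV[R]_d) = fun=> 0.
    by apply/funext => i; rewrite /row_seq; case: insub => //= j; rewrite mxE.
  by [].
by under eq_fun do rewrite E0; move/fine_cvgP => [].
Qed.

Lemma consistency_pnorm_test (kappa : nat -> R) (theta : triangular_array R) :
  consistency_set eps (pnorm_test p kappa) theta <->
  forall e : R, 0 < e -> \forall d \near \oo,
    acceptance eps p (row_seq (theta d)) d (Num.max (kappa d) 0 `^ p) <= e.
Proof.
have accE d := rejectionE eps p0 (row_seq (theta d)) d
  (Num.max (kappa d) 0 `^ p).
have acc0 d : 0 <= acceptance eps p (row_seq (theta d)) d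
    (Num.max (kappa d) 0 `^ p) by rewrite fine_ge0.
rewrite /consistency_set /=; under eq_fun do rewrite expectation_pnorm_test.
split=> [/fine_cvgP[_] /cvgrPdist_le H e e0|H].
- near=> d; have : `|1 - rejection eps p (row_seq (theta d)) d
      (Num.max (kappa d) 0 `^ p)| <= e by near: d; exact: H.
  by rewrite accE opprB addrC subrK ger0_norm.
- apply/fine_cvgP; split; first by near=> d.
  apply/cvgrPdist_le => e e0; near=> d.
  by rewrite /= accE opprB addrC subrK ger0_norm//; near: d; exact: H.
Unshelve. all: by end_near. Qed.

End pnorm_test_power.

Theorem corollary3p2 (R : realType) (disp : measure_display)
    (T : measurableType disp) (P : probability T R)
    (eps : nat -> {RV P >-> R}) (heps : iid_standard_normal eps)
    (p alpha : R) (kappa : nat -> R)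
    (hp : 0 < p) (halpha : 0 < alpha < 1)
    (hsize : tests_of_size eps alpha (pnorm_test p kappa)) :
  (2 <= p ->
    forall theta : triangular_array R,
      consistency_set eps (pnorm_test p kappa) theta <->
      (d%:R `^ (- 2^-1) *
        Num.max (pnorm 2 (theta d) `^ 2) (pnorm p (theta d) `^ p)
        @[d --> \oo] --> +oo)) /\
  (p < 2 ->
    (forall theta : triangular_array R,
      consistency_set eps (pnorm_test p kappa) theta ->
      (d%:R `^ (- 2^-1) *
        Num.min (pnorm 2 (theta d) `^ 2) (pnorm p (theta d) `^ p)
        @[d --> \oo] --> +oo)) /\
    (exists theta : triangular_array R,
      (d%:R `^ (- 2^-1) *
        Num.min (pnorm 2 (theta d) `^ 2) (pnorm p (theta d) `^ p)
        @[d --> \oo] --> +oo) /\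
      ~ consistency_set eps (pnorm_test p kappa) theta)).
Proof.
pose gam : probability R R := distribution P (eps 0).
have gamE B : measurable B -> gam B = normal_prob 0 1 B.
  by case: heps => _; apply.
have law i B : measurable B -> P (eps i @^-1` B) = gam B.
  by move=> mB; rewrite gamE//; case: heps => _; apply.
have indep : mutually_independent eps by case: heps.
have [A AE] : exists A : R -> R -> R, forall q t,
    A q t = \int[gam]_x `|t + x| `^ q by exists (fun q t => \int[gam]_x `|t + x| `^ q).
pose K d := Num.max (kappa d) 0 `^ p.
have [C [C0 KC]] : exists C, 0 < C /\ \forall d \near \oo,
    d%:R * A p 0 - C * Num.sqrt d%:R <= K d <= d%:R * A p 0 + C * Num.sqrt d%:R.
  exact: (critical_value_bounds gamE law indep hp AE halpha (size_pnorm_test hp hsize)).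
have Klb : \forall d \near \oo, d%:R * A p 0 - C * Num.sqrt d%:R <= K d.
  by apply: filterS KC => d /andP[].
have Kub : \forall d \near \oo, K d <= d%:R * A p 0 + C * Num.sqrt d%:R.
  by apply: filterS KC => d /andP[].
(* Consistency forces the sum of the [local_power] terms to outgrow [sqrt d], whatever [p] is. Both
   necessity claims and the counterexample follow from this. *)
have necessary theta M : consistency_set eps (pnorm_test p kappa) theta -> 0 < M ->
    \forall d \near \oo, M * Num.sqrt d%:R <
      \sum_(i < d) local_power p (row_seq (theta d) i).
  move=> /(consistency_pnorm_test eps hp) cons M0.
  have [delta delta0 Hdelta] :=
    acceptance_lower_bound gamE law indep hp AE C0 M0 Klb.
  near=> d; rewrite ltNge; apply/negP.
  have le_half : acceptance eps p (row_seq (theta d)) d (K d) <= delta / 2.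
    by near: d; apply: cons; rewrite divr_gt0.
  have ge_delta : forall th : nat -> R,
      \sum_(i < d) local_power p (th i) <= M * Num.sqrt d%:R ->
      delta <= acceptance eps p th d (K d) by near: d; exact: Hdelta.
  by move=> /ge_delta; lra.
split=> [p2 theta|p2].
  split=> [cons|].
    apply/cvgryPge => B; pose M := Num.max B 1.
    have M0 : 0 < M by rewrite lt_max ltr01 orbT.
    near=> d; have d0 : (0 < d)%N by near: d; exact: nbhs_infty_gt.
    (* The factor 2 compensates for bounding a sum of two terms by twice their maximum. *)
    have : 2 * M * Num.sqrt d%:R <
        \sum_(i < d) local_power p (row_seq (theta d) i).
      by near: d; apply: necessary; rewrite ?mulr_gt0.
    rewrite powR_half_le// pnorm2_sqr pnorm_powR//.
    set t2 := \sum_(i < d) _ ^+ 2; set tp := \sum_(i < d) `|_| `^ p.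
    have : \sum_(i < d) local_power p (row_seq (theta d) i) <= t2 + tp.
      by rewrite -big_split/=; apply: ler_sum => i _; exact: local_power_le_add.
    have : t2 <= Num.max t2 tp by rewrite le_max lexx.
    have : tp <= Num.max t2 tp by rewrite le_max lexx orbT.
    have : B * Num.sqrt d%:R <= M * Num.sqrt d%:R.
      by rewrite ler_wpM2r ?sqrtr_ge0// le_max lexx.
    lra.
  move=> /cvgryPge Hinf; apply/(consistency_pnorm_test eps hp).
  apply: (acceptance_to0 gamE law indep hp AE p2 C0 Kub
    (th := fun d => row_seq (theta d))).
  move=> B; near=> d; have d0 : (0 < d)%N by near: d; exact: nbhs_infty_gt.
  have : B <= d%:R `^ (- 2^-1) *
      Num.max (pnorm 2 (theta d) `^ 2) (pnorm p (theta d) `^ p).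
    by near: d; exact: Hinf.
  by rewrite powR_half_le// pnorm2_sqr pnorm_powR.
have p02 : 0 < p < 2 by rewrite hp.
split=> [theta cons|].
  apply/cvgryPge => B; pose M := Num.max B 1.
  have M0 : 0 < M by rewrite lt_max ltr01 orbT.
  near=> d; have d0 : (0 < d)%N by near: d; exact: nbhs_infty_gt.
  have MS : M * Num.sqrt d%:R <
      \sum_(i < d) local_power p (row_seq (theta d) i).
    by near: d; exact: necessary.
  rewrite powR_half_le// pnorm2_sqr pnorm_powR//.
  apply: (@le_trans _ _ (M * Num.sqrt d%:R)).
    by rewrite ler_wpM2r ?sqrtr_ge0// le_max lexx.
  apply: (le_trans (ltW MS)); rewrite le_min; apply/andP; split;
    by apply: ler_sum => i _; have [] := local_power_le_min (row_seq (theta d) i) p02.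
(* The large entry contributes [sqrt d] to the p-th powers but [d ^ (1 / p)] to the squares. The
   small ones contribute at most [sqrt d] to the squares but of order [d ^ (1 - p / 4)] to the p-th
   powers. For [p < 2] both larger exponents exceed 1/2, while [local_power] always sees the smaller
   contribution. *)
pose big d : R := d%:R `^ (2 * p)^-1; pose small d : R := d%:R `^ (- 4^-1).
pose th : triangular_array R := fun d =>
  \row_(i < d) (if i == 0 :> nat then big d else small d).
have thE d (i : 'I_d) : row_seq (th d) i = if i == 0 :> nat then big d else small d.
  by rewrite row_seqE mxE.
have big0 d : 0 <= big d by exact: powR_ge0.
have small0 d : 0 <= small d by exact: powR_ge0.
have bigp d : big d `^ p = Num.sqrt d%:R.
  by rewrite /big -powRrM invfM -mulrA mulVf ?gt_eqF// mulr1 powR12_sqrt ?ler0n.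
have small2 d : (0 < d)%N -> small d ^+ 2 * d%:R = Num.sqrt d%:R.
  move=> d0; have dR0 : 0 < d%:R :> R by rewrite ltr0n.
  rewrite -powR_mulrn// -powRrM -[X in _ * X]powRr1 ?ler0n// -powRD; last first.
    by rewrite (gt_eqF dR0) implybT.
  by rewrite -powR12_sqrt ?ler0n//; congr (_ `^ _); field.
have small_big d : (0 < d)%N -> small d <= big d.
  move=> d0; apply: ler_powR; first by rewrite ler1n.
  apply: (@le_trans _ _ 0); first by rewrite oppr_le0.
  by rewrite invr_ge0 mulr_ge0// ltW.
exists th; split.
  apply/cvgryPge => B; near=> d.
  have d0 : (0 < d)%N by near: d; exact: nbhs_infty_gt.
  have dR0 : 0 < d%:R :> R by rewrite ltr0n.
  rewrite powR_half_le// pnorm2_sqr pnorm_powR// le_min; apply/andP; split.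
    pose i0 := Ordinal d0.
    rewrite (bigD1 i0)// thE /= -[leLHS]addr0 lerD//; last first.
      by apply: sumr_ge0 => i _; exact: sqr_ge0.
    rewrite -powR_mulrn// -powRrM -powR12_sqrt ?ler0n//.
    have : B <= d%:R `^ (p^-1 - 2^-1).
      by near: d; apply: near_le_powR; rewrite subr_gt0 ltf_pV2 ?posrE.
    move=> /(ler_wpM2r (powR_ge0 d%:R (2^-1))) /le_trans; apply.
    rewrite -powRD; last by rewrite (gt_eqF dR0) implybT.
    by rewrite subrK invfM mulrAC mulVf// mul1r.
  apply: (@le_trans _ _ (\sum_(i < d) small d `^ p)).
    rewrite sumr_const card_ord -[leRHS]mulr_natl /small -powRrM -powR12_sqrt ?ler0n//.
    have : B <= d%:R `^ (2^-1 - p / 4).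
      by near: d; apply: near_le_powR; rewrite subr_gt0; lra.
    move=> /(ler_wpM2r (powR_ge0 d%:R (2^-1))) /le_trans; apply.
    rewrite -powRD; last by rewrite (gt_eqF dR0) implybT.
    rewrite -[X in _ <= X * _]powRr1 ?ler0n// -powRD; last first.
      by rewrite (gt_eqF dR0) implybT.
    by rewrite le_eqVlt; apply/orP; left; apply/eqP; congr (_ `^ _); field.
  apply: ler_sum => i _; rewrite thE; case: ifP => _; rewrite ger0_norm//.
  by rewrite ge0_ler_powR ?nnegrE ?small_big// ltW.
(* The large entry and the small entries each add at most [sqrt d] to the sum, which contradicts
   [necessary] with constant 2. *)
move=> /(necessary th 2) /(_ (ltr0Sn _ _)) H.
have : \forall d \near \oo, False; last by move=> [N _ /(_ N (leqnn N))].
near=> d; have d0 : (0 < d)%N by near: d; exact: nbhs_infty_gt.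
have : 2 * Num.sqrt d%:R < \sum_(i < d) local_power p (row_seq (th d) i).
  by near: d; exact: H.
apply/negP; rewrite -leNgt.
have small1 : \sum_(i < d) small d ^+ 2 = Num.sqrt d%:R.
  by rewrite sumr_const card_ord -[LHS]mulr_natr small2.
pose i0 := Ordinal d0.
rewrite (bigD1 i0)// mulrDl mul1r lerD//.
  rewrite thE/= -bigp -[in leRHS](ger0_norm (big0 d)).
  by have [] := local_power_le_min (big d) p02.
rewrite -small1 [leRHS](bigD1 i0)//= -[leLHS]add0r lerD ?sqr_ge0//.
apply: ler_sum => i i1; rewrite thE ifF.
  by have [] := local_power_le_min (small d) p02.
exact/negbTE.
Unshelve. all: by end_near. Qed.
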